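(* Let $J=\mathbb{N}$ or a finite initial section of $\mathbb{N}$, let $m\in\mathbb{N}$ ($m\ge 1$), let $S=\{\lambda_j\}_{j\in J}$ be a sequence in the open unit disc $\mathbb{D}$ (repetitions allowed) such that the measure $\sum_{j}(1-|\lambda_j|^2)\delta_{\lambda_j}$ is Carleson, and let $\alpha^i_j\in\mathbb{C}$ ($j\in J$, $1\le i\le m$) satisfy $\sum_{i=1}^m|\alpha^i_j|^2=1$ for all $j\in J$. Then there is a constant $D>0$ such that $$D^2\sum_{j}|c_j|^2\le \sum_{i=1}^m\Big\|\sum_j \alpha^i_jc_jk_{\lambda_j}\Big\|_{H^2}^2\qquad\text{for all } c=(c_j)\in\ell^2(J)$$ if and only if there are $\eta\in(0,1)$ and $D_0>0$ such that both of the following hold: (1) for every $j\in J$, the ball $\Delta(\lambda_j,\eta)$ contains no more than $m$ points of $S$, counting repetitions; (2) for every $j_1\in J$, if $\lambda_{j_1},\dots,\lambda_{j_p}$ ($p\le m$) are the points of $S$ in $\Delta(\lambda_{j_1},\eta)$, counting repetitions, then $$D_0^2\sum_{s=1}^p|c_{j_s}|^2\le\sum_{i=1}^m\Big|\sum_{s=1}^p\alpha^i_{j_s}c_{j_s}\Big|^2\qquad\text{for all }(c_{j_1},\dots,c_{j_p})\in\mathbb{C}^p,$$ that is, the $m\times p$ matrix $(\alpha^i_{j_s})_{1\le i\le m,\,1\le s\le p}$ is bounded below by $D_0$, where $D_0$ is one constant valid for all $j_1$ (it does not depend on $p$ or on the $\alpha$'s occurring in the matrix).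
   Context: $H^2$ is the Hardy space of the unit disc $\mathbb{D}$, and for $\lambda\in\mathbb{D}$, $k_\lambda(z)=(1-|\lambda|^2)^{1/2}/(1-\overline{\lambda}z)$ is the normalized reproducing kernel of $H^2$ at $\lambda$. The pseudo-hyperbolic metric is $\rho(z,w)=\left|\frac{z-w}{1-\overline{z}w}\right|$, and $\Delta(z,r)=\{w\in\mathbb{D}:\rho(z,w)<r\}$ for $0<r<1$. $\delta_\lambda$ is the unit point mass at $\lambda$. A positive measure $\mu$ on $\mathbb{D}$ is Carleson if there is a constant $C$ with $\int|f|^2d\mu\le C\|f\|^2$ for all $f\in H^2$. ''Counting repetitions'' means that the points of $S$ in a ball are counted by indices: the number of $j\in J$ with $\lambda_j$ in the ball. *)

(* Defs.v *)
From HB Require Import structures.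
From mathcomp Require Import all_boot all_order all_algebra.
From mathcomp Require Import all_classical all_reals all_analysis.
From mathcomp Require Export complex.

Set Implicit Arguments.
Unset Strict Implicit.
Unset Printing Implicit Defensive.

Import Order.TTheory GRing.Theory Num.Theory numFieldNormedType.Exports.

Local Open Scope classical_set_scope.
Local Open Scope ring_scope.

(* The real-valued modulus; the norm [`|z|] of [R[i]] is [R[i]]-valued. *)
Notation cmod := ComplexField.Normc.normc.

Definition unit_disc (R : realType) : set R[i] := [set z | cmod z < 1].
Arguments unit_disc {R}.

Definition pseudo_hyperbolic (R : realType) (z w : R[i]) : R :=
  cmod ((z - w) / (1 - conjc z * w)).

Definition ph_ball (R : realType) (z : R[i]) (r : R) : set R[i] :=
  [set w | unit_disc w /\ pseudo_hyperbolic z w < r].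

(* Elements of the Hardy space are represented by functions on [R[i]]; their
   values outside the unit disc are irrelevant.  [R[i]^o] is [R[i]] seen as a
   normed module over itself, hence with its usual topology. *)
Definition disc_expansion (R : realType) (f : R[i] -> R[i]) (a : nat -> R[i]) :=
  forall z : R[i], unit_disc z ->
    (fun n => \sum_(0 <= k < n) a k * z ^+ k : R[i]^o) @ \oo --> (f z : R[i]^o).

(* ||f||^2 = \sum_n |a_n|^2 for f(z) = \sum_n a_n z^n on the disc.  The sequence
   a is unique if it exists, so that the infimum ranges over one value;
   it is +oo when f has no such expansion. *)
Definition H2normsq (R : realType) (f : R[i] -> R[i]) : \bar R :=
  ereal_inf [set (\sum_(0 <= n <oo) (cmod (a n) ^+ 2)%:E)%E
            | a in disc_expansion f].

Definition H2 (R : realType) : set (R[i] -> R[i]) :=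
  [set f | (H2normsq f < +oo)%E].
Arguments H2 {R}.

Definition H2_sums_to (R : realType) (J : set nat) (F : nat -> R[i] -> R[i])
    (f : R[i] -> R[i]) :=
  H2 f /\
  (fun n => H2normsq (fun z => \sum_(0 <= j < n | j \in J) F j z - f z))
    @ \oo --> 0%E.

(* The sum of the series [\sum_(j in J) F j] in the norm of H^2; as for [lim],
   it is meaningful only when the series converges.  On the disc it does not
   depend on the choice made by [get]. *)
Definition H2_sum (R : realType) (J : set nat) (F : nat -> R[i] -> R[i]) :
    R[i] -> R[i] :=
  get (H2_sums_to J F : set (R[i] -> R[i]^o)).

Definition szego (R : realType) (l z : R[i]) : R[i] :=
  real_complex R (Num.sqrt (1 - cmod l ^+ 2)) / (1 - conjc l * z).

(* The complex numbers with their Borel sigma-algebra. *)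
Definition borelC (R : realType) := g_sigma_algebraType (@open (R[i]^o)).

Definition Carleson (R : realType) (mu : {measure set (borelC R) -> \bar R}) :=
  exists C : R, forall f : R[i] -> R[i], H2 f ->
    (\int[mu]_(z in (unit_disc : set (borelC R))) (cmod (f z) ^+ 2)%:E
       <= C%:E * H2normsq f)%E.

(* The maximum with 0 is there for typing only: it has no effect when
   [l] takes its values in the unit disc. *)
Definition mass (R : realType) (J : set nat) (l : nat -> R[i]) (j : nat) : R :=
  if j \in J then Num.max 0 (1 - cmod (l j) ^+ 2) else 0.

Lemma mass_ge0 (R : realType) (J : set nat) (l : nat -> R[i]) (j : nat) :
  0 <= mass J l j.
Proof. by rewrite /mass; case: ifP => // _; rewrite le_max lexx. Qed.

Definition point_masses (R : realType) (J : set nat) (l : nat -> R[i]) :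
    {measure set (borelC R) -> \bar R} :=
  mseries (fun j => mscale (NngNum (mass_ge0 J l j)) (dirac (l j : borelC R))) 0%N.

(* The indices, rather than the points: repetitions are counted. *)
Definition ball_indices (R : realType) (J : set nat) (l : nat -> R[i]) (r : R)
    (j : nat) : set nat :=
  [set k | J k /\ ph_ball (l j) r (l k)].

(* Main.v *)
Require Import Defs.
From mathcomp Require Import all_boot all_order all_algebra.
From mathcomp Require Import all_classical all_reals all_analysis.
From mathcomp Require Import complex.
From mathcomp Require Import measurable_realfun cyclic separable cyclotomic ring lra.

(** Throughout, [w_j = 1 - |lam_j|^2] and [k_j] is the normalized kernel at
[lam_j]; a function of the Hardy space is handled through its Taylor
coefficients, and norms through their finite partial sums.

Global to local.  If [lam_s] and [lam_j] are at pseudo-hyperbolic distance at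
most [eta], then [||k_s - k_j||^2 <= 2 eta^2] ([szego_coef_dist]).  For
coefficients carried by [p] indices in one ball of radius [eta], the sum
[sum_s alpha^i_s c_s k_s] therefore differs little from
[(sum_s alpha^i_s c_s) k_j], and the global lower bound becomes a lower bound
for the [m x p] matrix of the [alpha^i_s], as soon as [p <= m + 1] and [eta] is
small compared to [D / (m + 1)] ([local_bounded_below]).  Since an
[m x (m + 1)] matrix has a kernel, no ball can contain [m + 1] indices.

Local to global.  The points are not grouped into clusters: one test
function is attached to each index [j],
[F_j(z) = B_j(z) w_j^(3/2) / (1 - conj(lam_j) z)^2], where [B_j] is the Blaschke
product of the points outside the ball of [j] ([test_fun]).  Three facts make
it work.
- Pairing [f^i = sum_s alpha^i_s c_s k_s] with [F_j] keeps only the indices of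
  the ball of [j], so that the local hypothesis, applied to the
  coefficients [c_s sqrt(w_s) conj(F_j(lam_s))], gives
  [sum_i |<f^i, F_j>|^2 >= D0^2 |c_j|^2 |B_j(lam_j)|^2].
- The Carleson condition applied to [k_j] bounds
  [sum_k (1 - rho(lam_j, lam_k)^2)], hence [|B_j(lam_j)|] is bounded below
  ([blaschke_lower]).
- On the unit circle [|F_j|] is at most [sqrt(w_j)] times the Poisson kernel of
  [lam_j], which is at most [2 Re (1 / (1 - conj(lam_j) z))].  The modulus of
  [sum_j b_j F_j] is thus at most twice that of [sum_j |b_j| k_j]
  ([test_fun_dominated]), whose squared norm is at most [C sum_j |b_j|^2] by
  duality with the Carleson condition ([bessel]).  So the [F_j] satisfy a
  Bessel inequality: [sum_j |<f, F_j>|^2 <= 16 C ||f||^2]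
  ([test_value_bessel]).
Summing the first fact over [j] and the third over [i] gives the lower bound
for finitely many indices ([finite_lower_bound]).

The comparison of norms on the circle needs no integral: the functions
involved are uniform limits of polynomials on the closed disc, and for
polynomials the norm is the mean over the [n]-th roots of unity, for [n]
large ([parseval], [dominated_duality]).

Passing to square-summable coefficients uses that kernel series converge
([kernel_series_converges]) and that
[||f + g||^2 <= 2 ||f||^2 + 2 ||g||^2] ([H2normsqD]): constants being
irrelevant, this replaces the triangle inequality and the continuity of the
norm. *)

Set Implicit Arguments.
Unset Strict Implicit.
Unset Printing Implicit Defensive.

Import Order.TTheory GRing.Theory Num.Theory numFieldNormedType.Exports.

Local Open Scope classical_set_scope.
Local Open Scope ring_scope.

(** * The real-valued modulus *)

Section Modulus.
Variable R : realType.
Implicit Types (x y z : R[i]).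

Lemma cmodE z : `|z| = real_complex R (cmod z).
Proof. by []. Qed.

Lemma cmod_ge0 z : 0 <= cmod z.
Proof. by rewrite -ler0c -cmodE normr_ge0. Qed.

Lemma cmod0 : cmod (0 : R[i]) = 0.
Proof. exact: ComplexField.Normc.normc0. Qed.

Lemma cmod1 : cmod (1 : R[i]) = 1.
Proof. exact: ComplexField.Normc.normc1. Qed.

Lemma cmodM x y : cmod (x * y) = cmod x * cmod y.
Proof. exact: ComplexField.Normc.normcM. Qed.

Lemma cmodV x : cmod x^-1 = (cmod x)^-1.
Proof. exact: ComplexField.Normc.normcV. Qed.

Lemma cmodX x n : cmod (x ^+ n) = cmod x ^+ n.
Proof. by elim: n => [|n IH]; rewrite ?expr0 ?cmod1 // !exprS cmodM IH. Qed.

Lemma cmodN x : cmod (- x) = cmod x.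
Proof. by apply: complexI; rewrite -!cmodE normrN. Qed.

Lemma cmodJ x : cmod (conjc x) = cmod x.
Proof. by apply: complexI; rewrite -!cmodE normcJ. Qed.

Lemma cmodR (a : R) : cmod (real_complex R a) = `|a|.
Proof. by rewrite /= expr0n addr0 sqrtr_sqr. Qed.

Lemma cmodB x y : cmod (x - y) = cmod (y - x).
Proof. by rewrite -cmodN opprB. Qed.

Lemma cmodD x y : cmod (x + y) <= cmod x + cmod y.
Proof. by rewrite -lecR rmorphD -!cmodE /= ler_normD. Qed.

Lemma cmod_eq0 x : cmod x = 0 -> x = 0.
Proof. exact: ComplexField.Normc.eq0_normc. Qed.

Lemma cmod_neq0 x : x != 0 -> 0 < cmod x.
Proof.
move=> x0; rewrite lt_neqAle cmod_ge0 andbT eq_sym.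
by apply: contra x0 => /eqP/cmod_eq0->.
Qed.

Lemma cmod_sum (I : Type) (r : seq I) (P : pred I) (F : I -> R[i]) :
  cmod (\sum_(i <- r | P i) F i) <= \sum_(i <- r | P i) cmod (F i).
Proof.
elim/big_rec2: _ => [|i a b _ ab]; first by rewrite cmod0.
by apply: le_trans (cmodD _ _) _; rewrite lerD2l.
Qed.

Lemma cmod_prod (I : Type) (r : seq I) (P : pred I) (F : I -> R[i]) :
  cmod (\prod_(i <- r | P i) F i) = \prod_(i <- r | P i) cmod (F i).
Proof. by elim/big_rec2: _ => [|i a b _ <-]; rewrite ?cmod1 ?cmodM. Qed.

Lemma cmod_sqr z : real_complex R (cmod z ^+ 2) = z * conjc z.
Proof. by rewrite rmorphXn /= -[RHS]sqr_normc. Qed.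

Lemma cmod_sqrE z : cmod z ^+ 2 = complex.Re z ^+ 2 + complex.Im z ^+ 2.
Proof. by apply: complexI; rewrite add_Re2_Im2 -rmorphXn. Qed.

Lemma cmod_ge_Re z : `|complex.Re z| <= cmod z.
Proof. by rewrite -lecR -cmodE normc_ge_Re. Qed.

Lemma Re_sum (I : Type) (r : seq I) (P : pred I) (F : I -> R[i]) :
  complex.Re (\sum_(i <- r | P i) F i) = \sum_(i <- r | P i) complex.Re (F i).
Proof.
by apply: (big_morph (@complex.Re R)) => // -[? ?] [? ?].
Qed.

Lemma cmodB_lb x y : cmod x - cmod y <= cmod (x - y).
Proof. by rewrite lerBlDr -{1}[x](subrK y) cmodD. Qed.

(** Replaces the triangle inequality for norms throughout: working with
    squares and losing a factor 2 avoids square roots. *)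
Lemma sqrD_le (a b : R) : (a + b) ^+ 2 <= 2 * a ^+ 2 + 2 * b ^+ 2.
Proof. by have := sqr_ge0 (a - b); nra. Qed.

Lemma cmodD_sqr x y :
  cmod (x + y) ^+ 2 <= 2 * cmod x ^+ 2 + 2 * cmod y ^+ 2.
Proof.
apply: le_trans (sqrD_le _ _).
by rewrite lerXn2r ?nnegrE ?addr_ge0 ?cmod_ge0 ?cmodD.
Qed.

Lemma cauchy_schwarz (I : Type) (r : seq I) (P : pred I) (u v : I -> R) :
  (\sum_(i <- r | P i) u i * v i) ^+ 2 <=
  (\sum_(i <- r | P i) u i ^+ 2) * (\sum_(i <- r | P i) v i ^+ 2).
Proof.
set A := \sum_(i <- r | P i) u i ^+ 2; set B := \sum_(i <- r | P i) v i ^+ 2.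
set S := \sum_(i <- r | P i) u i * v i.
(* The quadratic form [sum_i (t u_i + s v_i)^2]; it is used at
   [(- S, A)], or at [(B + 1, - S)] when [A = 0]. *)
have q t s : 0 <= t ^+ 2 * A + 2 * (t * s) * S + s ^+ 2 * B.
  rewrite /A /B /S !mulr_sumr -!big_split /=; apply: sumr_ge0 => i _.
  by rewrite (_ : _ + _ = (t * u i + s * v i) ^+ 2) ?sqr_ge0 //; ring.
have A0 : 0 <= A by apply: sumr_ge0 => i _; rewrite sqr_ge0.
have B0 : 0 <= B by apply: sumr_ge0 => i _; rewrite sqr_ge0.
have [A00|An0] := eqVneq A 0.
  have := q (B + 1) (- S); rewrite A00 => h.
  have : 0 <= - (S ^+ 2 * (B + 2)).
    by apply: le_trans h _; rewrite le_eqVlt; apply/orP; left; apply/eqP; ring.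
  by rewrite oppr_ge0 pmulr_lle0 ?mul0r //; lra.
have Ap : 0 < A by rewrite lt_neqAle eq_sym An0.
have := q (- S) A; have -> : (- S) ^+ 2 * A + 2 * (- S * A) * S + A ^+ 2 * B =
   A * (A * B - S ^+ 2) by ring.
by rewrite pmulr_rge0 // subr_ge0.
Qed.

Lemma cauchy_schwarzC (I : Type) (r : seq I) (P : pred I) (u v : I -> R[i]) :
  cmod (\sum_(i <- r | P i) u i * v i) ^+ 2 <=
  (\sum_(i <- r | P i) cmod (u i) ^+ 2) *
  (\sum_(i <- r | P i) cmod (v i) ^+ 2).
Proof.
apply: le_trans (cauchy_schwarz _ _ _ _).
rewrite lerXn2r ?nnegrE ?cmod_ge0 //.
  by apply: sumr_ge0 => i _; rewrite mulr_ge0 ?cmod_ge0.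
apply: le_trans (cmod_sum _ _ _) _.
by apply: ler_sum => i _; rewrite cmodM.
Qed.

End Modulus.

(** * Parseval's identity over the roots of unity *)

Section Parseval.
Variable R : realType.
Implicit Types (x y z : R[i]) (p q : {poly R[i]}).

Lemma primitive_root_ex n : (0 < n)%N -> exists z : R[i], n.-primitive_root z.
Proof.
move=> n0; have [rs Ers] := closed_field_poly_normal ('X^n - 1 : {poly R[i]}).
rewrite (monicP _) ?monicXnsubC // scale1r in Ers.
have sz : (n < (size rs).+1)%N by rewrite -(size_prod_XsubC rs id) -Ers size_XnsubC.
have unit_rs : all n.-unity_root rs.
  by apply/allP => z; rewrite -root_prod_XsubC -Ers.
have uniq_rs : uniq rs.
  by rewrite -separable_prod_XsubC -Ers separable_Xn_sub_1 // pnatr_eq0 -lt0n.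
by have /hasP[z _ hz] := has_prim_root n0 unit_rs uniq_rs sz; exists z.
Qed.

Lemma cmod_unity n z : (0 < n)%N -> z ^+ n = 1 -> cmod z = 1.
Proof.
move=> n0 zn; have : cmod z ^+ n = 1 by rewrite -cmodX zn cmod1.
by move/eqP; rewrite pexpr_eq1 ?cmod_ge0 // => /eqP.
Qed.

Lemma mulcJ_unit z : cmod z = 1 -> z * conjc z = 1.
Proof. by move=> z1; rewrite -cmod_sqr z1 expr1n. Qed.

(** The sum is geometric with ratio [z ^ (k - l)], a root of unity that
    differs from 1 unless [k = l]. *)
Lemma root_orthogonality n z (k l : 'I_n) : n.-primitive_root z ->
  \sum_(t < n) z ^+ t ^+ k * conjc (z ^+ t ^+ l) = n%:R * (k == l)%:R.
Proof.
move=> zprim.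
have z1 := cmod_unity (prim_order_gt0 zprim) (prim_expr_order zprim).
pose x := z ^+ k * conjc (z ^+ l).
have -> : \sum_(t < n) z ^+ t ^+ k * conjc (z ^+ t ^+ l) = \sum_(t < n) x ^+ t.
  apply: eq_bigr => t _; rewrite /x exprMn -rmorphXn -!exprM.
  by rewrite (mulnC k) (mulnC l).
have zl1 : z ^+ l * conjc (z ^+ l) = 1 by rewrite mulcJ_unit // cmodX z1 expr1n.
have [kl|kl] := eqVneq k l.
  have -> : x = 1 by rewrite /x kl.
  by under eq_bigr do rewrite expr1n; rewrite sumr_const card_ord mulr1.
have x1 : x - 1 != 0.
  rewrite subr_eq0; apply: contra kl => /eqP xe.
  have : z ^+ k == z ^+ l.
    by rewrite -[z ^+ k]mulr1 -zl1 mulrCA -/x xe mulr1.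
  by rewrite (eq_prim_root_expr zprim) !modn_small.
apply: (mulfI x1); rewrite mulr0 mulr0 -subrX1.
rewrite /x exprMn -rmorphXn -!exprM !(mulnC _ n) !exprM (prim_expr_order zprim).
by rewrite !expr1n rmorph1 mulr1 subrr.
Qed.

(** The squared norm of a polynomial in the Hardy space. *)
Definition norm2 p : R := \sum_(k < size p) cmod p`_k ^+ 2.

Lemma norm2_wide p n : (size p <= n)%N -> norm2 p = \sum_(k < n) cmod p`_k ^+ 2.
Proof.
move=> pn; rewrite /norm2.
rewrite -!(big_mkord xpredT (fun k => cmod p`_k ^+ 2)).
rewrite (big_cat_nat (leq0n _) pn) /= [X in _ = _ + X]big1_seq ?addr0 // => k.
by rewrite mem_index_iota => /andP[_ /andP[pk _]]; rewrite nth_default // cmod0 expr0n.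
Qed.

Lemma norm2_poly n (a : nat -> R[i]) :
  norm2 (\poly_(k < n) a k) = \sum_(k < n) cmod (a k) ^+ 2.
Proof.
rewrite (norm2_wide (size_poly _ _)).
by apply: eq_bigr => k _; rewrite coef_poly ltn_ord.
Qed.

Lemma norm2_ge0 p : 0 <= norm2 p.
Proof. by apply: sumr_ge0 => k _; rewrite sqr_ge0. Qed.

Lemma parseval n z p : n.-primitive_root z -> (size p <= n)%N ->
  \sum_(t < n) cmod p.[z ^+ t] ^+ 2 = n%:R * norm2 p.
Proof.
move=> zprim pn; apply: complexI; rewrite rmorph_sum /=.
under eq_bigr do rewrite cmod_sqr (horner_coef_wide _ pn) rmorph_sum big_distrlr /=.
rewrite exchange_big /=; under eq_bigr do rewrite exchange_big /=.
rewrite (norm2_wide pn) rmorphM rmorph_nat rmorph_sum mulr_sumr.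
apply: eq_bigr => k _; rewrite [in RHS]/= cmod_sqr.
have E (l : 'I_n) : \sum_(t < n) p`_k * (z ^+ t) ^+ k * conjc (p`_l * (z ^+ t) ^+ l)
    = p`_k * conjc p`_l * (n%:R * (k == l)%:R).
  rewrite -(root_orthogonality k l zprim) mulr_sumr.
  by apply: eq_bigr => t _; rewrite rmorphM mulrACA.
rewrite (bigD1 k) //= [X in _ + X]big1 ?addr0 => [|l lk].
  by rewrite E eqxx mulr1 mulrC.
by rewrite E eq_sym (negbTE lk) !mulr0.
Qed.

(** A pointwise bound on the unit circle passes to norms, by averaging over
    the roots of unity of an order exceeding both degrees.  The additive
    error [e] leaves room for polynomials that only approximate the
    functions of interest. *)
Lemma norm2_dominated p q (e : R) : 0 <= e ->
  (forall z, cmod z = 1 -> cmod p.[z] <= 2 * cmod q.[z] + e) ->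
  norm2 p <= 8 * norm2 q + 2 * e ^+ 2.
Proof.
move=> e0 pq; pose n := (maxn (size p) (size q)).+1.
have [z zprim] := @primitive_root_ex n isT.
have zt t : cmod (z ^+ t) = 1.
  by rewrite cmodX (cmod_unity _ (prim_expr_order zprim)) // expr1n.
have n0 : (0 : R) < n%:R by rewrite ltr0n.
rewrite -(ler_pM2l n0) mulrDr mulrCA.
rewrite -!(parseval zprim) ?leqW ?leq_maxl ?leq_maxr //.
have -> : n%:R * (2 * e ^+ 2) = \sum_(t < n) 2 * e ^+ 2.
  by rewrite sumr_const card_ord mulr_natl.
rewrite mulr_sumr -big_split /=.
apply: ler_sum => t _.
apply: (@le_trans _ _ ((2 * cmod q.[z ^+ t] + e) ^+ 2)).
  by rewrite lerXn2r ?nnegrE ?addr_ge0 ?mulr_ge0 ?cmod_ge0 ?pq.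
by apply: le_trans (sqrD_le _ _) _; rewrite exprMn; lra.
Qed.

End Parseval.

(** * Uniform limits of polynomials on the closed disc *)

Section DiscAlgebra.
Variable R : realType.
Implicit Types (l x y z : R[i]) (p q : {poly R[i]}) (F G : R[i] -> R[i]).

(** Error terms are quadratic in [e] because the estimates bear on squares. *)
Lemma le_of_sqr_eps (X Y K : R) : 0 <= K ->
  (forall e, 0 < e -> X <= Y + e ^+ 2 * K) -> X <= Y.
Proof.
move=> K0 XY; apply/ler_addgt0Pr => d d0.
have K1 : 0 < K + 1 by lra.
have e0 : 0 < Num.sqrt (d / (K + 1)) by rewrite sqrtr_gt0 divr_gt0.
apply: le_trans (XY _ e0) _; rewrite lerD2l sqr_sqrtr; last by rewrite divr_ge0 // ltW.
by rewrite mulrAC ler_pdivrMr // ler_pM2l //; lra.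
Qed.

Lemma expr_small (a e : R) : 0 <= a < 1 -> 0 < e -> exists n, a ^+ n <= e.
Proof.
move=> /andP[a0 a1] e0.
have /cvgrPdist_le/(_ e e0) : (fun n => a ^+ n) @ \oo --> (0 : R).
  by apply: cvg_expr; rewrite ger0_norm.
case=> n _ /(_ n (leqnn n)) /=; rewrite sub0r normrN ger0_norm ?exprn_ge0 //.
by exists n.
Qed.

(** The disc algebra, by uniform approximation: contrary to a definition
    through coefficients, it is stable under products without Cauchy
    products of series. *)
Definition disc_algebra F := forall e : R, 0 < e ->
  exists p, forall z, cmod z <= 1 -> cmod (F z - p.[z]) <= e.

Lemma poly_bounded p : exists2 A : R, 0 <= A & forall z, cmod z <= 1 -> cmod p.[z] <= A.
Proof.
exists (\sum_(k < size p) cmod p`_k); first by apply: sumr_ge0 => k _; exact: cmod_ge0.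
move=> z z1; rewrite horner_coef; apply: le_trans (cmod_sum _ _ _) _.
apply: ler_sum => k _; rewrite cmodM cmodX ler_piMr ?cmod_ge0 //.
by rewrite exprn_ile1 ?cmod_ge0.
Qed.

Lemma disc_algebra_bounded F : disc_algebra F ->
  exists2 A : R, 0 <= A & forall z, cmod z <= 1 -> cmod (F z) <= A.
Proof.
move=> /(_ 1 ltr01)[p Fp]; have [A A0 pA] := poly_bounded p.
exists (1 + A); first by rewrite addr_ge0.
move=> z z1; rewrite -[F z](subrK p.[z]).
by apply: le_trans (cmodD _ _) _; rewrite lerD ?Fp ?pA.
Qed.

Lemma disc_algebra_poly p : disc_algebra (fun z => p.[z]).
Proof. by move=> e e0; exists p => z _; rewrite subrr cmod0 ltW. Qed.

Lemma disc_algebraM F G :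
  disc_algebra F -> disc_algebra G -> disc_algebra (fun z => F z * G z).
Proof.
move=> hF hG e e0.
have [A A0 FA] := disc_algebra_bounded hF.
have A1 : 0 < 2 * (A + 1) by lra.
have [q Gq] := hG _ (divr_gt0 e0 A1).
have [B B0 qB] := poly_bounded q.
have B1 : 0 < 2 * (B + 1) by lra.
have [p Fp] := hF _ (divr_gt0 e0 B1).
exists (p * q) => z z1; rewrite hornerM.
have -> : F z * G z - p.[z] * q.[z] = F z * (G z - q.[z]) + (F z - p.[z]) * q.[z].
  by ring.
apply: le_trans (cmodD _ _) _; rewrite !cmodM.
have h1 : cmod (F z) * cmod (G z - q.[z]) <= A * (e / (2 * (A + 1))).
  by rewrite ler_pM ?cmod_ge0 ?FA ?Gq.
have h2 : cmod (F z - p.[z]) * cmod q.[z] <= (e / (2 * (B + 1))) * B.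
  by rewrite ler_pM ?cmod_ge0 ?Fp ?qB.
apply: le_trans (lerD h1 h2) _.
have h3 : A * (e / (2 * (A + 1))) <= e / 2.
  rewrite mulrA ler_pdivrMr //; nra.
have h4 : (e / (2 * (B + 1))) * B <= e / 2.
  by rewrite mulrAC ler_pdivrMr //; nra.
lra.
Qed.

Lemma disc_algebraD F G :
  disc_algebra F -> disc_algebra G -> disc_algebra (fun z => F z + G z).
Proof.
move=> hF hG e e0; have e2 : 0 < e / 2 by lra.
have [p Fp] := hF _ e2; have [q Gq] := hG _ e2.
exists (p + q) => z z1; rewrite hornerD opprD addrACA.
by apply: le_trans (cmodD _ _) _; have := Fp z z1; have := Gq z z1; lra.
Qed.

Lemma disc_algebra_cst l : disc_algebra (fun=> l).
Proof. by move=> e e0; exists l%:P => z _; rewrite hornerC subrr cmod0 ltW. Qed.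

Lemma disc_algebra_sum (I : eqType) (r : seq I) (P : pred I) (F : I -> R[i] -> R[i]) :
  (forall i, i \in r -> P i -> disc_algebra (F i)) ->
  disc_algebra (fun z => \sum_(i <- r | P i) F i z).
Proof.
elim: r => [|i r IH] hF.
  have := disc_algebra_cst 0; congr disc_algebra.
  by apply/funext => z; rewrite big_nil.
have {}IH : disc_algebra (fun z => \sum_(i <- r | P i) F i z).
  by apply: IH => k kr; apply: hF; rewrite inE kr orbT.
case: (boolP (P i)) => Pi; last first.
  move: IH; congr disc_algebra.
  by apply/funext => z; rewrite big_cons (negbTE Pi).
have hi : disc_algebra (F i) by apply: hF; rewrite ?inE ?eqxx.
have := disc_algebraD hi IH; congr disc_algebra.
by apply/funext => z; rewrite big_cons Pi.
Qed.

Lemma disc_algebra_prod (I : eqType) (r : seq I) (P : pred I) (F : I -> R[i] -> R[i]) :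
  (forall i, i \in r -> P i -> disc_algebra (F i)) ->
  disc_algebra (fun z => \prod_(i <- r | P i) F i z).
Proof.
elim: r => [|i r IH] hF.
  have := disc_algebra_cst 1; congr disc_algebra.
  by apply/funext => z; rewrite big_nil.
have {}IH : disc_algebra (fun z => \prod_(i <- r | P i) F i z).
  by apply: IH => k kr; apply: hF; rewrite inE kr orbT.
case: (boolP (P i)) => Pi; last first.
  move: IH; congr disc_algebra.
  by apply/funext => z; rewrite big_cons (negbTE Pi).
have hi : disc_algebra (F i) by apply: hF; rewrite ?inE ?eqxx.
have := disc_algebraM hi IH; congr disc_algebra.
by apply/funext => z; rewrite big_cons Pi.
Qed.

Lemma cmod_1B l z : cmod l < 1 -> cmod z <= 1 -> 1 - cmod l <= cmod (1 - l * z).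
Proof.
move=> l1 z1; apply: le_trans (cmodB_lb _ _); rewrite cmod1 cmodM lerB //.
by rewrite ler_piMr ?cmod_ge0.
Qed.

Lemma sub1_neq0 l z : cmod l < 1 -> cmod z <= 1 -> 1 - l * z != 0.
Proof.
move=> l1 z1; apply/eqP => e; have := cmod_1B l1 z1; rewrite e cmod0.
lra.
Qed.

Lemma geometric_tail l z n : cmod l < 1 -> cmod z <= 1 ->
  (1 - l * z)^-1 - \sum_(k < n) l ^+ k * z ^+ k = (l * z) ^+ n / (1 - l * z).
Proof.
move=> l1 z1; have h := sub1_neq0 l1 z1.
under eq_bigr do rewrite -exprMn.
apply: (mulfI h); rewrite mulrBr divff // mulrCA divff // mulr1.
have -> : (1 - l * z) * \sum_(k < n) (l * z) ^+ k = 1 - (l * z) ^+ n.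
  by rewrite -(opprB _ 1) mulNr -subrX1 opprB.
by rewrite opprB addrCA subrr addr0.
Qed.

Lemma geometric_tail_le l z n : cmod l < 1 -> cmod z <= 1 ->
  cmod ((1 - l * z)^-1 - \sum_(k < n) l ^+ k * z ^+ k) <= cmod l ^+ n / (1 - cmod l).
Proof.
move=> l1 z1; rewrite geometric_tail // cmodM cmodV cmodX cmodM.
have h := cmod_1B l1 z1; have h0 : 0 < 1 - cmod l by lra.
apply: ler_pM; rewrite ?exprn_ge0 ?mulr_ge0 ?cmod_ge0 ?invr_ge0 ?cmod_ge0 //.
  by rewrite lerXn2r ?nnegrE ?mulr_ge0 ?cmod_ge0 // ler_piMr ?cmod_ge0.
by rewrite lef_pV2 ?posrE //; apply: lt_le_trans h.
Qed.

(** The partial sums of the geometric series converge uniformly on the closed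
    disc because the pole [1 / l] lies outside of it. *)
Lemma disc_algebra_inv l : cmod l < 1 -> disc_algebra (fun z => (1 - l * z)^-1).
Proof.
move=> l1 e e0; have h0 : 0 < 1 - cmod l by lra.
have [|n ln] := @expr_small (cmod l) (e * (1 - cmod l)) _ (mulr_gt0 e0 h0).
  by rewrite cmod_ge0.
exists (\poly_(k < n) l ^+ k) => z z1; rewrite horner_poly.
by apply: le_trans (geometric_tail_le n l1 z1) _; rewrite ler_pdivrMr.
Qed.

(** The [k]-th Taylor coefficient of [szego l]. *)
Definition szego_coef l (k : nat) : R[i] :=
  real_complex R (Num.sqrt (1 - cmod l ^+ 2)) * conjc l ^+ k.

Lemma szego_tail_le l z n : cmod l < 1 -> cmod z <= 1 ->
  cmod (szego l z - \sum_(k < n) szego_coef l k * z ^+ k)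
    <= cmod l ^+ n / (1 - cmod l).
Proof.
move=> l1 z1; rewrite /szego /szego_coef; under eq_bigr do rewrite -mulrA.
rewrite -mulr_sumr -mulrBr cmodM cmodR ger0_norm ?sqrtr_ge0 //.
have l1' : cmod (conjc l) < 1 by rewrite cmodJ.
apply: (@le_trans _ _ (1 * cmod ((1 - conjc l * z)^-1 -
    \sum_(k < n) conjc l ^+ k * z ^+ k))); last first.
  by rewrite mul1r -(cmodJ l); apply: geometric_tail_le.
rewrite ler_wpM2r ?cmod_ge0 // -[leRHS]sqrtr1 ler_sqrt ?ler01 //.
by rewrite gerBl sqr_ge0.
Qed.

Lemma szego_approx l e : cmod l < 1 -> 0 < e -> exists n0, forall n, (n0 <= n)%N ->
  forall z, cmod z <= 1 -> cmod (szego l z - \sum_(k < n) szego_coef l k * z ^+ k) <= e.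
Proof.
move=> l1 e0; have h0 : 0 < 1 - cmod l by lra.
have [|n0 ln] := @expr_small (cmod l) (e * (1 - cmod l)) _ (mulr_gt0 e0 h0).
  by rewrite cmod_ge0.
exists n0 => n n0n z z1; apply: le_trans (szego_tail_le n l1 z1) _.
rewrite ler_pdivrMr //; apply: le_trans ln.
by rewrite ler_wiXn2l ?cmod_ge0 // ltW.
Qed.

End DiscAlgebra.

(** * Pairing kernel combinations with the disc algebra *)

Section Duality.
Variables (R : realType) (lam : nat -> R[i]).
Implicit Types (r : seq nat) (b c : nat -> R[i]) (z : R[i]).

Definition comb_coef r c k : R[i] := \sum_(j <- r) c j * szego_coef (lam j) k.

Definition comb r c z : R[i] := \sum_(j <- r) c j * szego (lam j) z.

Lemma comb_approx r c e : {in r, forall j, unit_disc (lam j)} -> 0 < e ->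
  exists n0, forall n, (n0 <= n)%N -> forall z, cmod z <= 1 ->
    cmod (comb r c z - \sum_(k < n) comb_coef r c k * z ^+ k) <= e.
Proof.
elim: r e => [|j r IH] e rD e0.
  exists 0%N => n _ z _; rewrite /comb big_nil big1 ?subrr ?cmod0 ?ltW // => k _.
  by rewrite /comb_coef big_nil mul0r.
have e2 : 0 < e / 2 by lra.
have [i ri|n1 h1] := IH _ _ e2; first by apply: rD; rewrite inE ri orbT.
have K0 : 0 < 2 * (cmod (c j) + 1) by have := cmod_ge0 (c j); lra.
have [|n2 h2] := @szego_approx _ (lam j) _ _ (divr_gt0 e0 K0).
  by apply: rD; rewrite inE eqxx.
exists (maxn n1 n2) => n; rewrite geq_max => /andP[nn1 nn2] z z1.
rewrite /comb big_cons.
have -> : \sum_(k < n) comb_coef (j :: r) c k * z ^+ k =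
   c j * (\sum_(k < n) szego_coef (lam j) k * z ^+ k)
   + \sum_(k < n) comb_coef r c k * z ^+ k.
  rewrite mulr_sumr -big_split /=; apply: eq_bigr => k _.
  by rewrite /comb_coef big_cons mulrDl mulrA.
rewrite opprD addrACA -mulrBr; apply: le_trans (cmodD _ _) _.
rewrite cmodM; have a1 := h1 n nn1 z z1; have a2 := h2 n nn2 z z1.
have : cmod (c j) *
    cmod (szego (lam j) z - \sum_(k < n) szego_coef (lam j) k * z ^+ k) <= e / 2.
  apply: le_trans (ler_wpM2l (cmod_ge0 _) a2) _.
  by rewrite mulrA ler_pdivrMr //; have := cmod_ge0 (c j); nra.
by rewrite /comb in a1; lra.
Qed.

(** The reproducing property against polynomials, where it is a finite
    computation. *)
Lemma comb_poly r c (p : {poly R[i]}) :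
  \sum_(j <- r) c j * real_complex R (Num.sqrt (1 - cmod (lam j) ^+ 2))
     * conjc p.[lam j]
  = \sum_(k < size p) comb_coef r c k * conjc p`_k.
Proof.
rewrite /comb_coef; under [RHS]eq_bigr do rewrite mulr_suml.
rewrite exchange_big /=; apply: eq_bigr => j _.
rewrite horner_coef rmorph_sum mulr_sumr; apply: eq_bigr => k _.
by rewrite /szego_coef rmorphM rmorphXn; ring.
Qed.

(** The left side is the pairing of [f = comb r c] with [F].  Replacing [F] and
    [h = comb r b] by approximating polynomials [p] and [q], it is bounded by
    [||f|| ||p||], and the domination on the circle bounds [||p||^2] by
    [8 ||q||^2] up to an error; [q] is a Taylor polynomial of [h], so that
    [||q|| <= ||h||].  The other factor 2 is spent on the error made in
    replacing [F] by [p]. *)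
Lemma dominated_duality r b c (F : R[i] -> R[i]) (A H : R) :
  {in r, forall j, unit_disc (lam j)} ->
  disc_algebra F ->
  (forall z, cmod z = 1 -> cmod (F z) <= 2 * cmod (comb r b z)) ->
  (forall n, \sum_(k < n) cmod (comb_coef r c k) ^+ 2 <= A) ->
  (forall n, \sum_(k < n) cmod (comb_coef r b k) ^+ 2 <= H) ->
  cmod (\sum_(j <- r) c j * real_complex R (Num.sqrt (1 - cmod (lam j) ^+ 2))
          * conjc (F (lam j))) ^+ 2 <= 16 * (A * H).
Proof.
move=> rD hF Fh hA hH.
pose u j := c j * real_complex R (Num.sqrt (1 - cmod (lam j) ^+ 2)).
pose K := \sum_(j <- r) cmod (u j).
have K0 : 0 <= K by apply: sumr_ge0 => j _; exact: cmod_ge0.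
have A0 : 0 <= A by have := hA 0%N; rewrite big_ord0.
apply: (@le_of_sqr_eps _ _ _ (36 * A + 2 * K ^+ 2)) => [|e e0].
  by rewrite addr_ge0 ?mulr_ge0 ?sqr_ge0.
have [p Fp] := hF e e0.
have [n hn] := @comb_approx r b e rD e0.
pose q := \poly_(k < n) comb_coef r b k.
have hq z : cmod z <= 1 -> cmod (comb r b z - q.[z]) <= e.
  by move=> z1; rewrite horner_poly; apply: hn.
have pq : norm2 p <= 8 * norm2 q + 2 * (3 * e) ^+ 2.
  (* The error is [e] for [F] and [2 * e] for [2 * comb r b]. *)
  apply: norm2_dominated => [|z z1]; first by lra.
  have a1 := Fp z; have a2 := hq z; have a3 := Fh z z1; rewrite z1 in a1 a2.
  have b1 : cmod p.[z] <= cmod (F z) + cmod (F z - p.[z]).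
    by rewrite (cmodB (F z)) -{1}[p.[z]](subrK (F z)) addrC cmodD.
  have b2 : cmod (comb r b z) <= cmod q.[z] + cmod (comb r b z - q.[z]).
    by rewrite -{1}[comb r b z](subrK q.[z]) addrC cmodD.
  by have := a1 (lexx _); have := a2 (lexx _); lra.
have qH : norm2 q <= H by rewrite norm2_poly.
have main : cmod (\sum_(j <- r) u j * conjc p.[lam j]) ^+ 2
    <= A * (8 * H + 18 * e ^+ 2).
  rewrite /u comb_poly; apply: le_trans (cauchy_schwarzC _ _ _ _) _.
  under [X in _ * X]eq_bigr do rewrite cmodJ.
  rewrite ler_pM ?hA // ?norm2_ge0 //; first by apply: sumr_ge0 => k _; rewrite sqr_ge0.
  apply: le_trans pq _; nra.
have diff : cmod (\sum_(j <- r) u j * conjc (F (lam j))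
      - \sum_(j <- r) u j * conjc p.[lam j]) <= e * K.
  rewrite -sumrB; apply: le_trans (cmod_sum _ _ _) _.
  rewrite mulr_sumr big_seq [leRHS]big_seq; apply: ler_sum => j jr.
  rewrite -mulrBr -rmorphB cmodM cmodJ mulrC ler_wpM2r ?cmod_ge0 //.
  by apply: Fp; apply: ltW; exact: rD.
have -> : \sum_(j <- r) u j * conjc (F (lam j)) =
   \sum_(j <- r) u j * conjc p.[lam j] + (\sum_(j <- r) u j * conjc (F (lam j))
      - \sum_(j <- r) u j * conjc p.[lam j]) by rewrite addrC subrK.
apply: le_trans (cmodD_sqr _ _) _.
have : cmod (\sum_(j <- r) u j * conjc (F (lam j))
      - \sum_(j <- r) u j * conjc p.[lam j]) ^+ 2 <= (e * K) ^+ 2.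
  by rewrite lerXn2r ?nnegrE ?cmod_ge0 // mulr_ge0 // ltW.
rewrite exprMn; nra.
Qed.

End Duality.

(** * The pseudo-hyperbolic metric and Blaschke factors *)

Section PseudoHyperbolic.
Variable R : realType.
Implicit Types (l z w : R[i]).

(** The identity behind the pseudo-hyperbolic metric: it gives the value of
    [1 - rho^2] inside the disc, and the unimodularity of Blaschke factors
    when [w] is on the circle. *)
Lemma ph_identity z w :
  cmod (1 - conjc z * w) ^+ 2 - cmod (z - w) ^+ 2
  = (1 - cmod z ^+ 2) * (1 - cmod w ^+ 2).
Proof. by rewrite !cmod_sqrE; case: z w => [a b] [c d] /=; ring. Qed.

Lemma cmod_1BC z w : cmod (1 - conjc z * w) = cmod (1 - conjc w * z).
Proof. by rewrite -cmodJ rmorphB rmorph1 rmorphM /= conjcK mulrC. Qed.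

Lemma pseudo_hyperbolicE z w :
  pseudo_hyperbolic z w = cmod (z - w) / cmod (1 - conjc z * w).
Proof. by rewrite /pseudo_hyperbolic cmodM cmodV. Qed.

Lemma pseudo_hyperbolicC z w : pseudo_hyperbolic z w = pseudo_hyperbolic w z.
Proof. by rewrite !pseudo_hyperbolicE cmodB cmod_1BC. Qed.

Lemma pseudo_hyperbolic_ge0 z w : 0 <= pseudo_hyperbolic z w.
Proof. exact: cmod_ge0. Qed.

Lemma pseudo_hyperbolicxx z : pseudo_hyperbolic z z = 0.
Proof. by rewrite /pseudo_hyperbolic subrr mul0r cmod0. Qed.

Lemma cmod_1BJ_gt0 z w : unit_disc z -> cmod w <= 1 -> 0 < cmod (1 - conjc z * w).
Proof. by move=> z1 w1; apply/cmod_neq0/sub1_neq0; rewrite ?cmodJ. Qed.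

Lemma pseudo_hyperbolic_compl z w : unit_disc z -> unit_disc w ->
  1 - pseudo_hyperbolic z w ^+ 2
  = (1 - cmod z ^+ 2) * (1 - cmod w ^+ 2) / cmod (1 - conjc z * w) ^+ 2.
Proof.
move=> z1 w1; have /lt0r_neq0 h := cmod_1BJ_gt0 z1 (ltW w1).
rewrite -ph_identity pseudo_hyperbolicE mulrBl divff ?expf_neq0 //.
by rewrite expr_div_n.
Qed.

Lemma disc_weight_gt0 z : unit_disc z -> 0 < 1 - cmod z ^+ 2.
Proof. by rewrite /unit_disc /= => z1; have := cmod_ge0 z; nra. Qed.

Lemma pseudo_hyperbolic_le1 z w : unit_disc z -> unit_disc w ->
  pseudo_hyperbolic z w <= 1.
Proof.
move=> z1 w1; rewrite -(@ler_pXn2r _ 2) ?nnegrE ?pseudo_hyperbolic_ge0 // expr1n.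
rewrite -subr_ge0 pseudo_hyperbolic_compl // divr_ge0 ?sqr_ge0 // mulr_ge0 // ltW //;
  exact: disc_weight_gt0.
Qed.

Lemma cmod_szego_sqr l z : unit_disc l ->
  cmod (szego l z) ^+ 2 = (1 - cmod l ^+ 2) / cmod (1 - conjc l * z) ^+ 2.
Proof.
move=> l1; rewrite /szego cmodM cmodV cmodR exprMn real_normK ?num_real //.
by rewrite sqr_sqrtr ?exprVn // ltW // disc_weight_gt0.
Qed.

Lemma pseudo_hyperbolic_complE z w : unit_disc z -> unit_disc w ->
  1 - pseudo_hyperbolic z w ^+ 2 = (1 - cmod w ^+ 2) * cmod (szego z w) ^+ 2.
Proof.
by move=> z1 w1; rewrite pseudo_hyperbolic_compl // cmod_szego_sqr //; ring.
Qed.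

Definition blaschke l z : R[i] := (z - l) / (1 - conjc l * z).

Lemma cmod_blaschke l z : cmod (blaschke l z) = pseudo_hyperbolic l z.
Proof. by rewrite pseudo_hyperbolicE /blaschke cmodM cmodV cmodB. Qed.

Lemma blaschke_circle l z : unit_disc l -> cmod z = 1 -> cmod (blaschke l z) = 1.
Proof.
move=> l1 z1; rewrite /blaschke cmodM cmodV.
have h : 0 < cmod (1 - conjc l * z) by rewrite cmod_1BJ_gt0 ?z1.
have := ph_identity l z; rewrite z1 expr1n subrr mulr0 => /subr0_eq e.
suff -> : cmod (z - l) = cmod (1 - conjc l * z) by rewrite divff ?gt_eqF.
apply/eqP; rewrite -(@eqrXn2 _ 2) ?cmod_ge0 // cmodB; exact/eqP.
Qed.

Lemma disc_algebra_blaschke l : unit_disc l -> disc_algebra (blaschke l).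
Proof.
move=> l1; apply: disc_algebraM.
  have := disc_algebra_poly ('X - l%:P); congr disc_algebra.
  by apply/funext => z; rewrite hornerXsubC.
by apply: disc_algebra_inv; rewrite cmodJ.
Qed.

(** On the circle the Poisson kernel is [2 Re (1 / (1 - conj(l) z)) - 1]; up to
    the constant, it is the real part of an analytic function.  With
    [u = 1 - conj(l) z], the claim reads [1 - |1 - u|^2 <= 2 Re u]. *)
Lemma poisson_le_Re l z : unit_disc l -> cmod z = 1 ->
  (1 - cmod l ^+ 2) / cmod (1 - conjc l * z) ^+ 2
  <= 2 * complex.Re (1 - conjc l * z)^-1.
Proof.
move=> l1 z1; set u := 1 - conjc l * z.
have u0 : 0 < cmod u by rewrite cmod_1BJ_gt0 // z1.
have -> : complex.Re u^-1 = complex.Re u / cmod u ^+ 2.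
  by rewrite cmod_sqrE; case: (u).
rewrite mulrA ler_pM2r ?invr_gt0 ?exprn_gt0 //.
have -> : cmod l ^+ 2 = cmod (1 - u) ^+ 2.
  by rewrite /u opprB addrCA subrr addr0 cmodM cmodJ z1 mulr1.
rewrite !cmod_sqrE; case: (u) => a b /=.
by have := sqr_ge0 a; have := sqr_ge0 b; nra.
Qed.

End PseudoHyperbolic.

(** * Consequences of the Carleson inequality for polynomials *)

Section Carleson.
Variables (R : realType) (lam : nat -> R[i]).
Implicit Types (r : seq nat) (b c : nat -> R[i]) (z l : R[i]).

(** The Carleson inequality for the masses [1 - |lam_j|^2] at the points
    indexed by [r], tested on polynomials only. *)
Definition poly_carleson r (C : R) := forall p : {poly R[i]},
  \sum_(j <- r) (1 - cmod (lam j) ^+ 2) * cmod p.[lam j] ^+ 2 <= C * norm2 p.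

Lemma poly_carleson_ge0 r (C : R) : {in r, forall j, unit_disc (lam j)} ->
  poly_carleson r C -> 0 <= C.
Proof.
move=> rD hC; have : 0 <= C * norm2 (1 : {poly R[i]}).
  apply: le_trans (hC 1); rewrite big_seq; apply: sumr_ge0 => j jr.
  by rewrite mulr_ge0 ?sqr_ge0 // ltW // disc_weight_gt0 //; exact: rD.
by rewrite /norm2 size_poly1 big_ord1 coef1 eqxx cmod1 expr1n mulr1.
Qed.

(** Duality: if [p] is the Taylor polynomial of [comb r b] of degree less than
    [n] and [N] its squared norm, then [N] is the pairing of [comb r b] with
    [p], hence [N^2 <= (sum_j |b_j|^2) (sum_j w_j |p(lam_j)|^2)], where the
    last sum is at most [C N]. *)
Lemma bessel r (C : R) b n : {in r, forall j, unit_disc (lam j)} ->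
  poly_carleson r C ->
  \sum_(k < n) cmod (comb_coef lam r b k) ^+ 2 <= C * \sum_(j <- r) cmod (b j) ^+ 2.
Proof.
move=> rD hC; rewrite -norm2_poly; set p := \poly_(k < n) _.
set N := norm2 p; set B := \sum_(j <- r) _.
have N0 : 0 <= N := norm2_ge0 p.
have NN : N ^+ 2 <= B * (C * N).
  have E : N = cmod (\sum_(j <- r) b j * (real_complex R
       (Num.sqrt (1 - cmod (lam j) ^+ 2)) * conjc p.[lam j])).
    under eq_bigr do rewrite mulrA.
    rewrite comb_poly -[LHS]ger0_norm // -cmodR /N /norm2 rmorph_sum /=.
    congr cmod; apply: eq_bigr => k _; rewrite cmod_sqr; congr (_ * _).
    by rewrite coef_poly (leq_trans (ltn_ord k) (size_poly _ _)).
  rewrite E; apply: le_trans (cauchy_schwarzC _ _ _ _) _; rewrite -E.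
  rewrite ler_wpM2l //; first by apply: sumr_ge0 => j _; rewrite sqr_ge0.
  apply: le_trans (hC p); rewrite big_seq [leRHS]big_seq; apply: ler_sum => j jr.
  rewrite cmodM cmodJ cmodR exprMn real_normK ?num_real // sqr_sqrtr //.
  by rewrite ltW // disc_weight_gt0 //; exact: rD.
have [->|Nn0] := eqVneq N 0.
  rewrite mulr_ge0 ?(poly_carleson_ge0 rD hC) //.
  by apply: sumr_ge0 => j _; rewrite sqr_ge0.
have Np : 0 < N by rewrite lt_neqAle eq_sym Nn0.
by rewrite -(ler_pM2r Np) -expr2; apply: le_trans NN _; rewrite mulrCA mulrA.
Qed.

Lemma szego_coef_norm l n : unit_disc l ->
  \sum_(k < n) cmod (szego_coef l k) ^+ 2 <= 1.
Proof.
move=> l1.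
have -> : \sum_(k < n) cmod (szego_coef l k) ^+ 2 = 1 - (cmod l ^+ 2) ^+ n.
  rewrite -opprB subrX1 -mulNr opprB mulr_sumr; apply: eq_bigr => k _.
  rewrite /szego_coef cmodM cmodR exprMn real_normK ?num_real //.
  by rewrite sqr_sqrtr ?ltW ?disc_weight_gt0 // cmodX cmodJ -!exprM mulnC.
by rewrite gerBl exprn_ge0 ?sqr_ge0.
Qed.

(** The summand is [w_j |szego l (lam_j)|^2], and [szego l] has norm 1; the
    factor 2 comes from testing on its Taylor polynomials. *)
Lemma carleson_ph_sum r (C : R) l : {in r, forall j, unit_disc (lam j)} ->
  unit_disc l -> 0 <= C -> poly_carleson r C ->
  \sum_(j <- r) (1 - pseudo_hyperbolic l (lam j) ^+ 2) <= 2 * C.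
Proof.
move=> rD l1 C0 hC.
pose W := \sum_(j <- r) (1 - cmod (lam j) ^+ 2).
have W0 : 0 <= W.
  by rewrite /W big_seq; apply: sumr_ge0 => j /rD/disc_weight_gt0/ltW.
apply: (@le_of_sqr_eps _ _ _ (2 * W)); first by rewrite mulr_ge0.
move=> e e0; have [n hn] := szego_approx l1 e0.
pose p := \poly_(k < n) szego_coef l k.
have hp : norm2 p <= 1 by rewrite norm2_poly szego_coef_norm.
apply: (@le_trans _ _ (2 * (C * norm2 p) + e ^+ 2 * (2 * W))); last first.
  by rewrite lerD2r ler_pM2l // ler_piMr.
apply: (@le_trans _ _ (2 * (\sum_(j <- r) (1 - cmod (lam j) ^+ 2) * cmod p.[lam j] ^+ 2)
   + e ^+ 2 * (2 * W))); last by rewrite lerD2r ler_pM2l.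
rewrite /W !mulr_sumr -big_split /= big_seq [leRHS]big_seq.
apply: ler_sum => j jr; have lj := rD j jr.
rewrite pseudo_hyperbolic_complE //; have w0 := disc_weight_gt0 lj.
have := cmodD_sqr p.[lam j] (szego l (lam j) - p.[lam j]).
rewrite [p.[lam j] + _]addrC subrK.
have d : cmod (szego l (lam j) - p.[lam j]) <= e.
  by rewrite horner_poly; apply: hn => //; exact: ltW.
have d2 : cmod (szego l (lam j) - p.[lam j]) ^+ 2 <= e ^+ 2.
  by rewrite lerXn2r ?nnegrE ?cmod_ge0 // ltW.
move=> h; have {}h : cmod (szego l (lam j)) ^+ 2 <=
  2 * cmod p.[lam j] ^+ 2 + 2 * e ^+ 2 by lra.
apply: le_trans (ler_wpM2l (ltW w0) h) _.
by rewrite le_eqVlt; apply/orP; left; apply/eqP; ring.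
Qed.

(** This is [- ln y <= 1 / y - 1] for [y = x^2], where the right side is at
    most [(1 - y) / eta^2]. *)
Lemma expR_le_of_far (eta x : R) : 0 < eta -> eta <= x <= 1 ->
  expR (- ((1 - x ^+ 2) / eta ^+ 2)) <= x ^+ 2.
Proof.
move=> e0 /andP[ex x1]; have x0 : 0 < x by apply: lt_le_trans ex.
have x20 : 0 < x ^+ 2 by rewrite exprn_gt0.
have ex2 : eta ^+ 2 <= x ^+ 2 by rewrite lerXn2r ?nnegrE // ltW.
rewrite expRN -[leRHS]invrK lef_pV2 ?posrE ?expR_gt0 ?invr_gt0 //.
apply: le_trans (expR_ge1Dx _).
have -> : (x ^+ 2)^-1 = 1 + (1 - x ^+ 2) / x ^+ 2.
  by rewrite mulrBl divff ?gt_eqF // mul1r addrC subrK.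
rewrite lerD2l ler_wpM2l ?lef_pV2 ?posrE ?exprn_gt0 //.
by rewrite subr_ge0 expr_le1 // ltW.
Qed.

(** The factors are at least [eta], and the sum of their defects
    [1 - rho^2] is controlled by [carleson_ph_sum]. *)
Lemma blaschke_lower r (C eta : R) l : {in r, forall j, unit_disc (lam j)} ->
  unit_disc l -> 0 <= C -> 0 < eta -> poly_carleson r C ->
  expR (- (2 * C / eta ^+ 2)) <=
  cmod (\prod_(k <- r | eta <= pseudo_hyperbolic l (lam k)) blaschke (lam k) l) ^+ 2.
Proof.
move=> rD l1 C0 e0 hC.
rewrite cmod_prod -prodrXl.
apply: (@le_trans _ _ (\prod_(k <- r | eta <= pseudo_hyperbolic l (lam k))
   expR (- ((1 - pseudo_hyperbolic l (lam k) ^+ 2) / eta ^+ 2)))).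
  rewrite -expR_sum ler_expR sumrN lerN2 -mulr_suml ler_wpM2r ?invr_ge0 ?sqr_ge0 //.
  apply: le_trans (carleson_ph_sum rD l1 C0 hC).
  rewrite [leRHS](bigID (fun k => eta <= pseudo_hyperbolic l (lam k))) /= lerDl.
  rewrite big_seq_cond; apply: sumr_ge0 => k /andP[/rD lk _].
  by rewrite subr_ge0 expr_le1 ?pseudo_hyperbolic_ge0 // pseudo_hyperbolic_le1.
rewrite big_seq_cond [leRHS]big_seq_cond; apply: ler_prod => k /andP[/rD lk ek].
rewrite expR_ge0 cmod_blaschke (pseudo_hyperbolicC (lam k)) /=.
by apply: expR_le_of_far => //; rewrite ek pseudo_hyperbolic_le1.
Qed.

End Carleson.

(** * The lower bound for finitely many points *)

Section LowerBound.
Variables (R : realType) (lam : nat -> R[i]) (eta : R).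
Implicit Types (r : seq nat) (b c d : nat -> R[i]) (z l : R[i]).

Definition sqrt_weight j : R := Num.sqrt (1 - cmod (lam j) ^+ 2).

(** The Blaschke product kills the points outside the ball of [j].  The
    square of the kernel, instead of the kernel itself, makes the modulus of
    the other factor a multiple of the Poisson kernel on the circle, which
    is positive: the upper bound then survives multiplication by the
    Blaschke products, which vary with [j]. *)
Definition test_fun r j z : R[i] :=
  \prod_(k <- r | eta <= pseudo_hyperbolic (lam j) (lam k)) blaschke (lam k) z *
  (real_complex R (sqrt_weight j ^+ 3) * ((1 - conjc (lam j) * z)^-1 ^+ 2)).

Lemma disc_algebra_test_fun r j : {in r, forall j, unit_disc (lam j)} ->
  unit_disc (lam j) -> disc_algebra (test_fun r j).
Proof.
move=> rD lj; have hi : disc_algebra (fun z => (1 - conjc (lam j) * z)^-1).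
  by apply: disc_algebra_inv; rewrite cmodJ.
apply: disc_algebraM; last first.
  by apply: disc_algebraM; [exact: disc_algebra_cst | exact: (disc_algebraM hi hi)].
by apply: disc_algebra_prod => k /rD lk _; exact: disc_algebra_blaschke.
Qed.

Lemma test_fun_vanish r j s : s \in r ->
  eta <= pseudo_hyperbolic (lam j) (lam s) -> test_fun r j (lam s) = 0.
Proof.
move=> sr es; rewrite /test_fun.
suff -> : \prod_(k <- r | eta <= pseudo_hyperbolic (lam j) (lam k))
   blaschke (lam k) (lam s) = 0 by rewrite mul0r.
by rewrite (big_rem s) //= es /blaschke subrr !mul0r.
Qed.

Lemma sqr_sqrt_weight j : unit_disc (lam j) ->
  sqrt_weight j ^+ 2 = 1 - cmod (lam j) ^+ 2.
Proof. by move=> lj; rewrite sqr_sqrtr // ltW // disc_weight_gt0. Qed.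

(** The normalization of the kernel factor is such that, with the weight
    [sqrt_weight j] of the pairing, it contributes exactly 1. *)
Lemma test_fun_center r j : unit_disc (lam j) ->
  cmod (test_fun r j (lam j)) * sqrt_weight j =
  cmod (\prod_(k <- r | eta <= pseudo_hyperbolic (lam j) (lam k))
          blaschke (lam k) (lam j)).
Proof.
move=> lj; have w0 := disc_weight_gt0 lj; have sw := sqr_sqrt_weight lj.
rewrite /test_fun 2!cmodM -mulrA.
have -> : 1 - conjc (lam j) * lam j = real_complex R (sqrt_weight j ^+ 2).
  by rewrite sw rmorphB rmorph1 /= cmod_sqr mulrC.
rewrite cmodX cmodV !cmodR !ger0_norm ?exprn_ge0 ?sqrtr_ge0 // -exprVn.
have s0 : sqrt_weight j != 0 by rewrite gt_eqF // sqrtr_gt0.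
rewrite [X in _ * X](_ : _ = 1) ?mulr1 //.
by field.
Qed.

Lemma test_fun_circle r j z : {in r, forall j, unit_disc (lam j)} ->
  unit_disc (lam j) -> cmod z = 1 ->
  cmod (test_fun r j z) <= sqrt_weight j * (2 * complex.Re (1 - conjc (lam j) * z)^-1).
Proof.
move=> rD lj z1; rewrite /test_fun cmodM cmod_prod big_seq_cond big1 ?mul1r; last first.
  by move=> k /andP[/rD lk _]; rewrite blaschke_circle.
rewrite cmodM cmodR ger0_norm ?exprn_ge0 ?sqrtr_ge0 // exprS -mulrA.
rewrite ler_wpM2l ?sqrtr_ge0 //.
apply: le_trans (poisson_le_Re lj z1).
by rewrite sqr_sqrt_weight // cmodX cmodV exprVn.
Qed.

(** The moduli [|b_j|] only multiply nonnegative upper bounds, each of which is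
    the real part of an analytic function; so their sum is the real part of
    a single kernel combination. *)
Lemma test_fun_dominated r b z : {in r, forall j, unit_disc (lam j)} ->
  cmod z = 1 ->
  cmod (\sum_(j <- r) b j * test_fun r j z) <=
  2 * cmod (comb lam r (fun j => real_complex R (cmod (b j))) z).
Proof.
move=> rD z1; set h := comb _ _ _ _.
apply: (@le_trans _ _ (2 * complex.Re h)); last first.
  by rewrite ler_pM2l // (le_trans (ler_norm _)) ?cmod_ge0 // cmod_ge_Re.
have -> : complex.Re h = \sum_(j <- r) cmod (b j) * (sqrt_weight j *
     complex.Re (1 - conjc (lam j) * z)^-1).
  rewrite /h /comb.
  rewrite Re_sum; apply: eq_bigr => j _; rewrite /szego -/(sqrt_weight j).
  by case: (1 - _)^-1 => x y /=; rewrite !mul0r !subr0.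
apply: le_trans (cmod_sum _ _ _) _; rewrite mulr_sumr big_seq [leRHS]big_seq.
apply: ler_sum => j /[dup] jr /rD lj; rewrite cmodM mulrCA ler_wpM2l ?cmod_ge0 //.
by rewrite mulrCA; exact: test_fun_circle.
Qed.

(** The pairing of [comb lam r c] with [test_fun r j]. *)
Definition test_value r c j : R[i] :=
  \sum_(s <- r) c s * (real_complex R (sqrt_weight s) * conjc (test_fun r j (lam s))).

(** Choose the coefficients [b_j = test_value r c j] in the combination
    [F = sum_j b_j F_j]: the pairing of [comb lam r c] with [F] is then
    [L = sum_j |b_j|^2] itself, while [dominated_duality] and [bessel] bound
    [L^2] by [16 A (C L)]. *)
Lemma test_value_bessel r c (C A : R) : {in r, forall j, unit_disc (lam j)} ->
  poly_carleson lam r C ->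
  (forall n, \sum_(k < n) cmod (comb_coef lam r c k) ^+ 2 <= A) ->
  \sum_(j <- r) cmod (test_value r c j) ^+ 2 <= 16 * (A * C).
Proof.
move=> rD hC hA; set L := \sum_(j <- r) _.
have L0 : 0 <= L by apply: sumr_ge0 => j _; rewrite sqr_ge0.
pose b := test_value r c; pose h j := real_complex R (cmod (b j)).
have hH n : \sum_(k < n) cmod (comb_coef lam r h k) ^+ 2 <= C * L.
  apply: le_trans (bessel _ _ rD hC) _; rewrite le_eqVlt; apply/orP; left; apply/eqP.
  by congr (_ * _); apply: eq_bigr => j _; rewrite cmodR real_normK ?num_real.
have := @dominated_duality _ lam r h c (fun z => \sum_(j <- r) b j * test_fun r j z)
   A (C * L) rD _ _ hA hH.
have -> : \sum_(j <- r) c j * real_complex R (Num.sqrt (1 - cmod (lam j) ^+ 2)) *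
   conjc (\sum_(j0 <- r) b j0 * test_fun r j0 (lam j)) = real_complex R L.
  under eq_bigr do rewrite rmorph_sum mulr_sumr.
  rewrite exchange_big /= /L rmorph_sum; apply: eq_bigr => j _.
  rewrite [RHS]/= cmod_sqr -/(b j) [in RHS]mulrC [X in _ = _ * X]/b mulr_sumr.
  by apply: eq_bigr => s _; rewrite rmorphM /sqrt_weight; ring.
rewrite cmodR ger0_norm // => main.
have {}main : L ^+ 2 <= 16 * (A * (C * L)).
  apply: main => [|z z1]; last exact: test_fun_dominated.
  apply: disc_algebra_sum => j /rD lj _.
  by apply: disc_algebraM; [exact: disc_algebra_cst | exact: disc_algebra_test_fun].
have [->|Ln0] := eqVneq L 0.
  have A0 : 0 <= A by have := hA 0%N; rewrite big_ord0.
  by rewrite !mulr_ge0 ?(poly_carleson_ge0 rD hC).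
have Lp : 0 < L by rewrite lt_neqAle eq_sym Ln0.
by rewrite -(ler_pM2r Lp) -expr2; apply: le_trans main _; rewrite !mulrA.
Qed.

(** The hypothesis is applied, in the ball of each [j], to
    [d_s = c_s sqrt(w_s) conj(F_j(lam_s))]; of the resulting lower bound, only
    the term [s = j] is kept. *)
Lemma finite_lower_bound r m (alpha : 'I_m -> nat -> R[i]) c (C D0 : R)
    (A : 'I_m -> R) :
  {in r, forall j, unit_disc (lam j)} -> 0 < eta -> poly_carleson lam r C ->
  {in r, forall j d,
     D0 ^+ 2 *
       \sum_(s <- r | pseudo_hyperbolic (lam j) (lam s) < eta) cmod (d s) ^+ 2 <=
     \sum_(i < m) cmod (\sum_(s <- r | pseudo_hyperbolic (lam j) (lam s) < eta)
        alpha i s * d s) ^+ 2} ->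
  (forall i n,
     \sum_(k < n) cmod (comb_coef lam r (fun j => alpha i j * c j) k) ^+ 2 <= A i) ->
  D0 ^+ 2 * expR (- (2 * C / eta ^+ 2)) * \sum_(j <- r) cmod (c j) ^+ 2 <=
  16 * C * \sum_(i < m) A i.
Proof.
move=> rD e0 hC hloc hA; have C0 := poly_carleson_ge0 rD hC.
apply: (@le_trans _ _ (\sum_(i < m) \sum_(j <- r)
    cmod (test_value r (fun j => alpha i j * c j) j) ^+ 2)); last first.
  rewrite mulr_sumr; apply: ler_sum => i _.
  by rewrite -mulrA [C * _]mulrC; apply: test_value_bessel.
rewrite exchange_big /= mulr_sumr big_seq [leRHS]big_seq; apply: ler_sum => j jr.
have lj := rD j jr.
pose d s := c s * (real_complex R (sqrt_weight s) * conjc (test_fun r j (lam s))).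
have := hloc j jr d.
have -> : \sum_(i < m) cmod (\sum_(s <- r | pseudo_hyperbolic (lam j) (lam s) < eta)
        alpha i s * d s) ^+ 2 =
  \sum_(i < m) cmod (test_value r (fun j => alpha i j * c j) j) ^+ 2.
  apply: eq_bigr => i _; congr (cmod _ ^+ 2); rewrite /test_value big_mkcond /=.
  rewrite big_seq [RHS]big_seq; apply: eq_bigr => s sr.
  case: ltP => [_|es]; first by rewrite /d mulrA.
  by rewrite test_fun_vanish // conjc0 !mulr0.
apply: le_trans.
rewrite -mulrA ler_wpM2l ?sqr_ge0 //.
rewrite (big_rem j) //= pseudo_hyperbolicxx e0.
apply: le_trans (_ : cmod (d j) ^+ 2 <= _); last first.
  by rewrite lerDl; apply: sumr_ge0 => s _; rewrite sqr_ge0.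
rewrite /d !cmodM cmodJ cmodR ger0_norm ?sqrtr_ge0 // [sqrt_weight j * _]mulrC.
rewrite test_fun_center // exprMn mulrC ler_wpM2l ?sqr_ge0 //.
exact: blaschke_lower.
Qed.

End LowerBound.

(** * Kernels at nearby points *)

Section NearbyKernels.
Variable R : realType.
Implicit Types (l z w : R[i]).

(** The expression on the right is the real part of the inner product of
    [szego w] and [szego z].  Its modulus is [sqrt(1 - rho^2)], and its
    argument is small as well: with [u = 1 - conj(w) z], the claim amounts to
    [Re u >= sqrt(1 - |w|^2) sqrt(1 - |z|^2)], which follows from
    [Re u >= 1 - |w| |z|]. *)
Lemma szego_inner_Re z w : unit_disc z -> unit_disc w ->
  1 - pseudo_hyperbolic w z ^+ 2 <=
  complex.Re (szego w z * real_complex R (Num.sqrt (1 - cmod z ^+ 2))).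
Proof.
move=> z1 w1; rewrite pseudo_hyperbolic_compl //.
have w0 := ltW (disc_weight_gt0 w1); have z0 := ltW (disc_weight_gt0 z1).
rewrite /szego; set u := 1 - conjc w * z.
set t := Num.sqrt (1 - cmod w ^+ 2); set s := Num.sqrt (1 - cmod z ^+ 2).
have t0 : 0 <= t by exact: sqrtr_ge0.
have s0 : 0 <= s by exact: sqrtr_ge0.
have -> : complex.Re (real_complex R t / u * real_complex R s) =
    t * s * complex.Re u / cmod u ^+ 2.
  by rewrite cmod_sqrE; case: (u) => a b /=; ring.
rewrite -{1}(sqr_sqrtr w0) -{1}(sqr_sqrtr z0) -/t -/s.
rewrite ler_wpM2r ?invr_ge0 ?sqr_ge0 // -exprMn expr2 ler_wpM2l ?mulr_ge0 //.
(* Here [(1 - |w||z|)^2 - (1 - |w|^2) (1 - |z|^2) = (|w| - |z|)^2]. *)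
apply: (@le_trans _ _ (1 - cmod w * cmod z)).
  rewrite -(@ler_pXn2r _ 2) ?nnegrE ?mulr_ge0 //; last first.
    by rewrite subr_ge0 mulr_ile1 ?cmod_ge0 ?ltW.
  rewrite exprMn /t /s !sqr_sqrtr //.
  by have := sqr_ge0 (cmod w - cmod z); nra.
have : complex.Re u = 1 - complex.Re (conjc w * z) by rewrite /u; case: (conjc w * z).
move=> ->; rewrite lerD2l lerN2 -(cmodJ w) -cmodM.
by apply: le_trans (cmod_ge_Re _); exact: ler_norm.
Qed.

Lemma cmodB_sqr z w :
  cmod (z - w) ^+ 2 = cmod z ^+ 2 + cmod w ^+ 2 - 2 * complex.Re (z * conjc w).
Proof. by rewrite !cmod_sqrE; case: z w => [a b] [c d] /=; ring. Qed.

(** The full sum is [2 - 2 Re <szego w, szego z>], the kernels having norm 1. *)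
Lemma szego_coef_dist z w n : unit_disc z -> unit_disc w ->
  \sum_(k < n) cmod (szego_coef w k - szego_coef z k) ^+ 2
  <= 2 * pseudo_hyperbolic w z ^+ 2.
Proof.
move=> z1 w1; apply/ler_addgt0Pr => e e0.
have e2 : 0 < e / 2 by lra.
have [n0 hn0] := szego_approx w1 e2.
pose N := maxn n n0.
apply: (@le_trans _ _ (\sum_(k < N) cmod (szego_coef w k - szego_coef z k) ^+ 2)).
  rewrite -!(big_mkord xpredT (fun k => cmod (szego_coef w k - szego_coef z k) ^+ 2)).
  rewrite [leRHS](big_cat_nat (leq0n _) (leq_maxl n n0)) /= lerDl.
  by apply: sumr_ge0 => k _; rewrite sqr_ge0.
set s := Num.sqrt (1 - cmod z ^+ 2).
have hs : 0 <= s <= 1.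
  rewrite sqrtr_ge0 /= -[leRHS]sqrtr1 ler_sqrt ?ler01 // gerBl sqr_ge0 //.
have -> : \sum_(k < N) cmod (szego_coef w k - szego_coef z k) ^+ 2 =
  \sum_(k < N) cmod (szego_coef w k) ^+ 2 + \sum_(k < N) cmod (szego_coef z k) ^+ 2
  - 2 * complex.Re ((\sum_(k < N) szego_coef w k * z ^+ k) * real_complex R s).
  under eq_bigr do rewrite cmodB_sqr.
  rewrite sumrB big_split /= -mulr_sumr; congr (_ - 2 * _).
  rewrite mulr_suml Re_sum.
  apply: eq_bigr => k _; congr complex.Re; rewrite /szego_coef -/s.
  have -> : conjc (real_complex R s * conjc z ^+ k) = real_complex R s * z ^+ k.
    by rewrite rmorphM rmorphXn /= conjcK oppr0.
  by ring.
have := szego_inner_Re z1 w1; rewrite -/s => hRe.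
have := szego_coef_norm N w1; have := szego_coef_norm N z1.
have hd : complex.Re (szego w z * real_complex R s)
   - complex.Re ((\sum_(k < N) szego_coef w k * z ^+ k) * real_complex R s) <= e / 2.
  have -> (x y : R[i]) : complex.Re x - complex.Re y = complex.Re (x - y).
    by case: x y => [? ?] [? ?].
  rewrite -mulrBl; apply: le_trans (ler_norm _) _; apply: le_trans (cmod_ge_Re _) _.
  rewrite cmodM cmodR; have := hn0 N (leq_maxr _ _) z (ltW z1).
  move: hs => /andP[s0 s1]; rewrite ger0_norm // => h.
  by have := cmod_ge0 (szego w z - \sum_(k < N) szego_coef w k * z ^+ k); nra.
by move=> h1 h2; lra.
Qed.

(** Replacing each kernel by the one at [l] turns the combination into
    [(sum_j a_j c_j) szego l]; the remainder is estimated by the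
    Cauchy-Schwarz inequality and [szego_coef_dist]. *)
Lemma comb_coef_nearby (lam : nat -> R[i]) (r : seq nat) (a c : nat -> R[i]) l
    (eta : R) n :
  unit_disc l -> {in r, forall j, unit_disc (lam j)} ->
  {in r, forall j, pseudo_hyperbolic l (lam j) <= eta} ->
  \sum_(k < n) cmod (comb_coef lam r (fun j => a j * c j) k) ^+ 2 <=
  2 * cmod (\sum_(j <- r) a j * c j) ^+ 2 +
  4 * eta ^+ 2 * ((\sum_(j <- r) cmod (a j) ^+ 2) * (\sum_(j <- r) cmod (c j) ^+ 2)).
Proof.
move=> l1 rD rho.
pose S := \sum_(j <- r) a j * c j.
pose d j k := szego_coef (lam j) k - szego_coef l k.
have E k : comb_coef lam r (fun j => a j * c j) k =
    S * szego_coef l k + \sum_(j <- r) c j * (a j * d j k).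
  rewrite /S mulr_suml -big_split /=; apply: eq_bigr => j _; rewrite /d; ring.
apply: (@le_trans _ _ (\sum_(k < n) (2 * (cmod S ^+ 2 * cmod (szego_coef l k) ^+ 2) +
   2 * ((\sum_(j <- r) cmod (c j) ^+ 2) *
        \sum_(j <- r) cmod (a j) ^+ 2 * cmod (d j k) ^+ 2)))).
  apply: ler_sum => k _; rewrite E; apply: le_trans (cmodD_sqr _ _) _.
  rewrite cmodM exprMn lerD2l ler_pM2l //.
  apply: le_trans (cauchy_schwarzC _ _ _ _) _.
  by under [X in _ * X <= _]eq_bigr do rewrite cmodM exprMn.
rewrite big_split /= -!mulr_sumr lerD //.
  by rewrite ler_pM2l // ler_piMr ?sqr_ge0 ?szego_coef_norm.
rewrite exchange_big /= [leRHS](_ : _ = 2 * ((\sum_(j <- r) cmod (c j) ^+ 2) *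
    \sum_(j <- r) cmod (a j) ^+ 2 * (2 * eta ^+ 2))); last by rewrite -mulr_suml; ring.
rewrite ler_pM2l // ler_wpM2l //; first by apply: sumr_ge0 => j _; rewrite sqr_ge0.
rewrite big_seq [leRHS]big_seq; apply: ler_sum => j jr; rewrite -mulr_sumr.
rewrite ler_wpM2l ?sqr_ge0 //; apply: le_trans (szego_coef_dist _ l1 (rD j jr)) _.
rewrite ler_pM2l // pseudo_hyperbolicC lerXn2r ?nnegrE ?rho //.
  exact: pseudo_hyperbolic_ge0.
exact: le_trans (pseudo_hyperbolic_ge0 _ _) (rho j jr).
Qed.

End NearbyKernels.

(** * Taylor coefficients and the norm of the Hardy space *)

Section HardyNorm.
Variable R : realType.
Implicit Types (a b : nat -> R[i]) (z : R[i]) (f g : R[i] -> R[i]).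

(** Translates the topology of [R[i]], whose neighbourhoods are given by
    complex-valued radii, into real estimates. *)
Lemma cvg_cmodP (u : nat -> R[i]) (l : R[i]) :
  (u : nat -> R[i]^o) @ \oo --> (l : R[i]^o) <->
  forall e : R, 0 < e -> exists n0, forall n, (n0 <= n)%N -> cmod (l - u n) <= e.
Proof.
split=> [/cvgrPdist_le ul e e0|ul].
  have [|n0 _ hn0] := ul (real_complex R e); first by rewrite ltcR.
  by exists n0 => n /hn0; rewrite /= lecR.
apply/cvgrPdist_le => eps; case: eps => e y; rewrite ltcE /= => /andP[/eqP y0 e0].
have [n0 hn0] := ul e e0; exists n0 => // n /= /hn0 h.
rewrite y0 -[leRHS]/(real_complex R e) -[leLHS]/(real_complex R (cmod (l - u n))).
by rewrite lecR.
Qed.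

Lemma normsq_le a (A : R) : (forall n, \sum_(k < n) cmod (a k) ^+ 2 <= A) ->
  (\sum_(0 <= n <oo) (cmod (a n) ^+ 2)%:E <= A%:E)%E.
Proof.
move=> hA; apply: lime_le.
  by apply: is_cvg_nneseries => n _ _; rewrite lee_fin sqr_ge0.
by near=> n; rewrite sumEFin lee_fin big_mkord.
Unshelve. all: end_near. Qed.

Lemma normsq_ge a n :
  ((\sum_(k < n) cmod (a k) ^+ 2)%:E <= \sum_(0 <= n <oo) (cmod (a n) ^+ 2)%:E)%E.
Proof.
have := @nneseries_lim_ge R (fun n => (cmod (a n) ^+ 2)%:E) xpredT 0 n.
by rewrite sumEFin big_mkord; apply=> k _ _; rewrite lee_fin sqr_ge0.
Qed.

Lemma H2normsq_le f a (A : R) : disc_expansion f a ->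
  (forall n, \sum_(k < n) cmod (a k) ^+ 2 <= A) -> (H2normsq f <= A%:E)%E.
Proof.
move=> fa hA; apply: ge_ereal_inf.
by exists (\sum_(0 <= n <oo) (cmod (a n) ^+ 2)%:E)%E; [exists a | exact: normsq_le].
Qed.

Lemma H2normsq_ge0 f : (0 <= H2normsq f)%E.
Proof.
apply/ereal_infP => _ [a _ <-].
by apply: nneseries_ge0 => n _ _; rewrite lee_fin sqr_ge0.
Qed.

Lemma disc_expansionD f g a b : disc_expansion f a -> disc_expansion g b ->
  disc_expansion (fun z => f z + g z) (fun k => a k + b k).
Proof.
move=> fa gb z zD.
have -> : (fun n => \sum_(0 <= k < n) (a k + b k) * z ^+ k : R[i]^o) =
  (fun n => (\sum_(0 <= k < n) a k * z ^+ k : R[i]^o) +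
            (\sum_(0 <= k < n) b k * z ^+ k : R[i]^o)).
  apply/funext => n; rewrite -big_split; apply: eq_bigr => k _ /=.
  by rewrite mulrDl.
exact: cvgD (fa z zD) (gb z zD).
Qed.

(** Reduces an inequality between possibly infinite values to finite upper
    bounds of the terms on the right. *)
Lemma lee_twice (x y z : \bar R) : (0 <= x)%E -> (0 <= y)%E ->
  (forall F G : R, (x < F%:E)%E -> (y < G%:E)%E -> (z <= (2 * F + 2 * G)%:E)%E) ->
  (z <= 2%:E * x + 2%:E * y)%E.
Proof.
have pinf (u : \bar R) : (0 <= u)%E -> (2%:E * u + +oo = +oo)%E.
  by move=> u0; rewrite addey // -ltNye (lt_le_trans ltNy0) // mule_ge0.
case: x => [F| |] // x0 y0 h; last by rewrite gt0_muley ?lte_fin // addeC pinf ?leey.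
case: y y0 h => [G| |] // y0 h; last first.
  by rewrite [(_ * +oo)%E]gt0_muley ?lte_fin // pinf ?leey.
apply/lee_addgt0Pr => e e0; have e4 : 0 < e / 4 by lra.
have := h (F + e / 4) (G + e / 4); rewrite !lte_fin !ltrDl => /(_ e4 e4).
move=> {}h; apply: le_trans h _; rewrite -!EFinM -!EFinD lee_fin; lra.
Qed.

(** Any pair of expansions of [f] and [g] yields one of [f + g], so that the
    inequality for coefficients passes to the infima. *)
Lemma H2normsqD f g :
  (H2normsq (fun z => (f z + g z)%R)
   <= 2%:E * H2normsq f + 2%:E * H2normsq g)%E.
Proof.
apply: lee_twice (H2normsq_ge0 f) (H2normsq_ge0 g) _ => F G.
move=> /ereal_inf_lt[_ [a fa <-] ha] /ereal_inf_lt[_ [b gb <-] hb].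
apply: (H2normsq_le (disc_expansionD fa gb)) => n.
have ha' : \sum_(k < n) cmod (a k) ^+ 2 <= F.
  by rewrite -lee_fin; apply: le_trans (normsq_ge a n) (ltW ha).
have hb' : \sum_(k < n) cmod (b k) ^+ 2 <= G.
  by rewrite -lee_fin; apply: le_trans (normsq_ge b n) (ltW hb).
apply: (@le_trans _ _ (\sum_(k < n) (2 * cmod (a k) ^+ 2 + 2 * cmod (b k) ^+ 2))).
  by apply: ler_sum => k _; exact: cmodD_sqr.
by rewrite big_split /= -!mulr_sumr lerD // ler_pM2l.
Qed.

Lemma geometric_sum_le (x : R) m n : 0 <= x < 1 ->
  \sum_(m <= k < n) x ^+ k <= x ^+ m / (1 - x).
Proof.
move=> /andP[x0 x1]; have h : 0 < 1 - x by lra.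
have [nm|mn] := leqP n m.
  by rewrite big_geq // divr_ge0 ?exprn_ge0 // ltW.
rewrite ler_pdivlMr // mulrC.
suff -> : (1 - x) * \sum_(m <= k < n) x ^+ k = x ^+ m - x ^+ n.
  by rewrite gerBl exprn_ge0.
rewrite mulr_sumr (@telescope_sumr_eq _ _ _ (fun k => - x ^+ k)) ?(ltnW mn) //.
  by rewrite opprK addrC.
by move=> k _; rewrite exprS; ring.
Qed.

(** By strong induction on [k]: convergence at [1/2] bounds [a_k] by a
    multiple of [2^k], and then, at a small real [t], the terms of degree
    more than [k] add up to [O(t^(k+1))], which forces [a_k = O(t)]. *)
Lemma power_series_eq0 a :
  (forall z, unit_disc z -> forall e : R, 0 < e ->
     exists n0, forall n, (n0 <= n)%N -> cmod (\sum_(0 <= k < n) a k * z ^+ k) <= e) ->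
  forall k, a k = 0.
Proof.
move=> ha.
have [M M0 hM] : exists2 M : R, 0 <= M & forall k, cmod (a k) <= M * 2 ^+ k.
  pose z := real_complex R (1 / 2).
  have cz : cmod z = 1 / 2 by rewrite cmodR ger0_norm.
  have [|n0 hn0] := ha z _ 1 ltr01.
    by rewrite -[unit_disc z]/(is_true (cmod z < 1)) cz; lra.
  pose S := \sum_(j < n0) cmod (a j) * (1 / 2) ^+ j.
  have S0 : 0 <= S by apply: sumr_ge0 => j _; rewrite mulr_ge0 ?cmod_ge0 ?exprn_ge0.
  have hS k : cmod (a k) * (1 / 2) ^+ k <= 2 + S.
    have [kn|nk] := ltnP k n0.
      rewrite /S (bigD1 (Ordinal kn)) //=.
      have : 0 <= \sum_(i < n0 | i != Ordinal kn) cmod (a i) * (1 / 2) ^+ i.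
        by apply: sumr_ge0 => j _; rewrite mulr_ge0 ?cmod_ge0 ?exprn_ge0.
      by lra.
    have h1 := hn0 k nk; have := hn0 k.+1 (leqW nk).
    rewrite big_nat_recr //= => h2.
    rewrite -cz -cmodX -cmodM.
    set T := \sum_(0 <= i < k) _ in h1 h2.
    have -> : a k * z ^+ k = (T + a k * z ^+ k) - T by rewrite addrC addKr.
    apply: le_trans (cmodD _ _) _; rewrite cmodN; lra.
  exists (2 + S) => [|k]; first by lra.
  by have := hS k; rewrite expr_div_n expr1n mulrA mulr1 ler_pdivrMr // exprn_gt0.
move=> k; elim/ltn_ind: k => k IH.
apply: cmod_eq0; apply/eqP; rewrite eq_le cmod_ge0 andbT.
pose K := 2 * M * 2 ^+ k.+1.
have K0 : 0 <= K by rewrite !mulr_ge0 ?exprn_ge0.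
suff ht t : 0 < t <= 1 / 4 -> cmod (a k) <= K * t.
  apply/ler_addgt0Pr => e e0; rewrite add0r.
  have K1 : 0 < K + 1 by lra.
  pose t := Num.min (1 / 4) (e / (K + 1)).
  apply: (le_trans (ht t _)).
    by rewrite ge_min lexx andbT lt_min !divr_gt0.
  apply: (@le_trans _ _ (K * (e / (K + 1)))).
    by rewrite ler_wpM2l // ge_min lexx orbT.
  rewrite mulrA ler_pdivrMr //; nra.
move=> /andP[t0 t4]; rewrite -(ler_pM2r (exprn_gt0 k t0)).
apply/ler_addgt0Pr => e e0.
pose z := real_complex R t.
have cz : cmod z = t by rewrite cmodR gtr0_norm.
have [|n0 hn0] := ha z _ e e0.
  by rewrite -[unit_disc z]/(is_true (cmod z < 1)) cz; lra.
pose n := maxn n0 k.+1.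
have := hn0 n (leq_maxl _ _).
have kn : (k.+1 <= n)%N := leq_maxr _ _.
rewrite (big_cat_nat (leq0n k.+1) kn) /= big_nat_recr //= big1_seq ?add0r; last first.
  by move=> j; rewrite mem_index_iota => /andP[_ /andP[_ jk]]; rewrite IH // mul0r.
set T := \sum_(_ <= _ < _) _ => hle.
have hT : cmod T <= M * (2 * (2 * t) ^+ k.+1).
  apply: le_trans (cmod_sum _ _ _) _.
  apply: (@le_trans _ _ (M * \sum_(k.+1 <= j < n) (2 * t) ^+ j)).
    rewrite mulr_sumr; apply: ler_sum => j _.
    by rewrite cmodM cmodX cz exprMn mulrA ler_wpM2r ?hM // exprn_ge0 // ltW.
  have t2 : 0 <= 2 * t < 1 by apply/andP; split; lra.
  rewrite ler_wpM2l //; apply: le_trans (geometric_sum_le _ _ t2) _.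
  have x0 : 0 <= (2 * t) ^+ k.+1 by rewrite exprn_ge0 // mulr_ge0 // ltW.
  by rewrite ler_pdivrMr; [nra | lra].
have -> : cmod (a k) * t ^+ k = cmod (a k * z ^+ k) by rewrite cmodM cmodX cz.
have -> : a k * z ^+ k = (a k * z ^+ k + T) - T by rewrite addrK.
apply: le_trans (cmodD _ _) _; rewrite cmodN.
have -> : K * t * t ^+ k = M * (2 * (2 * t) ^+ k.+1).
  by rewrite /K exprMn exprS [t ^+ k.+1]exprS; ring.
lra.
Qed.

Lemma disc_expansion_uniq f a b : disc_expansion f a -> disc_expansion f b -> a = b.
Proof.
move=> fa fb; apply/funext => k; apply/subr0_eq; move: k.
apply: power_series_eq0 => z zD e e0; have e2 : 0 < e / 2 by lra.
have [n1 h1] := (cvg_cmodP _ _).1 (fa z zD) _ e2.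
have [n2 h2] := (cvg_cmodP _ _).1 (fb z zD) _ e2.
exists (maxn n1 n2) => n; rewrite geq_max => /andP[/h1 {}h1 /h2 {}h2].
under eq_bigr do rewrite mulrBl.
rewrite sumrB -[X in cmod X](subrKA (f z)).
by apply: le_trans (cmodD _ _) _; rewrite cmodB; lra.
Qed.

Lemma H2normsq_ge f a n : disc_expansion f a ->
  ((\sum_(k < n) cmod (a k) ^+ 2)%:E <= H2normsq f)%E.
Proof.
move=> fa; apply/ereal_infP => _ [b fb <-].
by rewrite (disc_expansion_uniq fa fb) normsq_ge.
Qed.

Lemma disc_expansion_comb (lam : nat -> R[i]) r c :
  {in r, forall j, unit_disc (lam j)} ->
  disc_expansion (comb lam r c) (comb_coef lam r c).
Proof.
move=> rD z zD; apply/cvg_cmodP => e e0.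
have [n0 hn0] := @comb_approx _ lam r c e rD e0; exists n0 => n /hn0.
by rewrite big_mkord; apply; exact: ltW.
Qed.

Lemma disc_expansion_poly (p : {poly R[i]}) : disc_expansion (fun z => p.[z]) (nth 0 p).
Proof.
move=> z _; apply/cvg_cmodP => e e0; exists (size p) => n pn.
by rewrite (horner_coef_wide _ pn) big_mkord subrr cmod0 ltW.
Qed.

Lemma H2normsq_poly (p : {poly R[i]}) : (H2normsq (fun z => p.[z]) <= (norm2 p)%:E)%E.
Proof.
apply: (H2normsq_le (@disc_expansion_poly p)) => n.
rewrite (norm2_wide (leq_maxl (size p) n)).
rewrite -!(big_mkord xpredT (fun k => cmod p`_k ^+ 2)).
rewrite [leRHS](big_cat_nat (leq0n _) (leq_maxr (size p) n)) /= lerDl.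
by apply: sumr_ge0 => k _; rewrite sqr_ge0.
Qed.

End HardyNorm.

(** * From the Carleson measure to sums over its points *)

Section CarlesonMeasure.
Variable R : realType.
Implicit Types (p : {poly R[i]}) (z : R[i]).

Lemma continuous_hornerC p : continuous (fun z : R[i]^o => p.[z] : R[i]^o).
Proof.
elim/poly_ind: p => [|p c IH] z.
  have -> : (fun z : R[i]^o => (0 : {poly R[i]}).[z] : R[i]^o) = cst 0.
    by apply/funext => x; rewrite horner0.
  exact: cst_continuous.
have -> : (fun z : R[i]^o => (p * 'X + c%:P).[z] : R[i]^o) =
   (fun z : R[i]^o => (p.[z] : R[i]^o) * z + c).
  by apply/funext => x; rewrite hornerMXaddC.
exact: (cvgD (cvgM (IH z) (@cvg_id _ (nbhs z))) (@cvg_cst _ (c : R[i]^o) _ (nbhs z) _)).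
Qed.

Lemma open_cmod_gt (b : R) : open ([set z | b < cmod z] : set R[i]^o).
Proof.
rewrite openE => z /= bz; apply/nbhs_ballP.
exists (real_complex R (cmod z - b)); first by rewrite /= ltcR subr_gt0.
move=> w; rewrite -ball_normE /= => h.
have {}h : cmod (z - w) < cmod z - b by rewrite -ltcR.
have := cmodB_lb z (z - w); rewrite subKr.
by lra.
Qed.

Lemma open_unit_disc : open (unit_disc : set R[i]^o).
Proof.
have := @ball_open _ R[i]^o 0 1; congr open.
apply/funext => z; apply/propext; rewrite -ball_normE /= sub0r normrN.
by rewrite -[`|z|]/(real_complex R (cmod z)) -[1]/(real_complex R 1) ltcR.
Qed.

Lemma measurable_unit_disc : measurable (unit_disc : set (borelC R)).
Proof. apply: sub_sigma_algebra; exact: open_unit_disc. Qed.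

Lemma measurable_cmod_horner p (D : set (borelC R)) : measurable D ->
  measurable_fun D (fun z : borelC R => cmod p.[z]).
Proof.
move=> mD; apply: measurable_funTS.
move=> _; apply: (measurability _ (RGenOInfty.measurableE R)) => //.
move=> /= _ [_ [x ->] <-]; rewrite setTI; apply: sub_sigma_algebra.
have := @open_cmod_gt x.
move=> /(open_comp (f := fun z : R[i]^o => p.[z] : R[i]^o)).
have -> : (fun z : borelC R => cmod p.[z]) @^-1` `]x, +oo[%classic =
   (fun z : R[i]^o => p.[z] : R[i]^o) @^-1` [set z | x < cmod z].
  by apply/funext => z; apply/propext; rewrite /= in_itv /= andbT.
by apply => z _; exact: continuous_hornerC.
Qed.

(** On the disc, the integral against the measure is the sum of the weighted
    values at the points. *)
Lemma Carleson_poly (J : set nat) (lam : nat -> R[i]) :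
  (forall j, J j -> unit_disc (lam j)) -> Carleson (point_masses J lam) ->
  exists2 C : R, 0 < C &
    forall n, poly_carleson lam [seq j <- index_iota 0 n | j \in J] C.
Proof.
move=> hlam [C0 hC0]; exists (Num.max 1 C0) => [|n p]; first by rewrite lt_max ltr01.
have f0 z : (0 <= (cmod p.[z] ^+ 2)%:E)%E by rewrite lee_fin sqr_ge0.
have mf : measurable_fun (unit_disc : set (borelC R))
    ((fun z => (cmod p.[z] ^+ 2)%:E) : borelC R -> \bar R).
  apply/measurable_EFinP; apply: measurable_funX.
  exact: measurable_cmod_horner measurable_unit_disc.
have H2p : H2 (fun z => p.[z]).
  by rewrite /H2 /=; apply: le_lt_trans (H2normsq_poly p) _; rewrite ltry.
have := hC0 _ H2p; rewrite /point_masses ge0_integral_measure_series //=; last first.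
  exact: measurable_unit_disc.
move=> h; rewrite -lee_fin.
apply: (@le_trans _ _ (C0%:E * H2normsq (fun z => p.[z]))%E); last first.
  rewrite EFinM.
  apply: (@le_trans _ _ ((Num.max 1 C0)%:E * H2normsq (fun z => p.[z]))%E).
    by rewrite lee_wpmul2r ?H2normsq_ge0 // lee_fin le_max lexx orbT.
  by rewrite lee_wpmul2l ?H2normsq_poly // lee_fin le_max ler01.
apply: le_trans h; rewrite big_filter /=.
rewrite -sumEFin.
set F := (X in (_ <= \big[_/_]_(0 <= k <oo) X k)%E).
have F0 k : (0 <= F k)%E by apply: integral_ge0 => z _.
apply: (@le_trans _ _ (\sum_(0 <= k < n) F k)%E); last first.
  by apply: nneseries_lim_ge => k _ _.
rewrite big_mkcond /=; apply: lee_sum => k _.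
have [kJ|_] := boolP (k \in J); last exact: F0.
have lk : unit_disc (lam k) by apply: hlam; rewrite -in_setE.
have w0 := ltW (disc_weight_gt0 lk).
rewrite /F ge0_integral_mscale //=; last exact: measurable_unit_disc.
rewrite integral_dirac //; last exact: measurable_unit_disc.
rewrite diracE mem_set // mul1e /mass kJ.
by rewrite (max_idPr w0) -EFinM.
Qed.

End CarlesonMeasure.

(** * Convergence of complex sequences and power series *)

Section Completeness.
Variable R : realType.
Implicit Types (a b : nat -> R[i]) (z : R[i]) (f g : R[i] -> R[i]).

(** The real and imaginary parts are Cauchy sequences of real numbers. *)
Lemma cauchy_cvgC (u : nat -> R[i]) :
  (forall e : R, 0 < e -> exists n0, forall m n, (n0 <= m)%N -> (m <= n)%N ->
     cmod (u n - u m) <= e) ->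
  exists l : R[i], forall e : R, 0 < e -> exists n0, forall n, (n0 <= n)%N ->
     cmod (l - u n) <= e.
Proof.
move=> hu.
have real_case (v : nat -> R) : (forall e : R, 0 < e -> exists n0, forall m n,
     (n0 <= m)%N -> (m <= n)%N -> `|v n - v m| <= e) -> v @ \oo --> limn v.
  move=> hv; apply/cauchy_cvgP/cauchy_exP => e e0.
  have e2 : 0 < e / 2 by lra.
  have [n0 hn0] := hv _ e2; exists (v n0); exists n0 => // n /= n0n.
  by rewrite -ball_normE /= distrC; apply: le_lt_trans (hn0 _ _ _ n0n) _ => //; lra.
have hRe := real_case (fun n => complex.Re (u n)).
have hIm := real_case (fun n => complex.Im (u n)).
have {}hRe : (fun n => complex.Re (u n)) @ \oo --> limn (fun n => complex.Re (u n)).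
  apply: hRe => e e0; have [n0 hn0] := hu e e0; exists n0 => m n m0 mn.
  apply: le_trans (hn0 m n m0 mn); apply: le_trans (cmod_ge_Re _).
  by case: (u n) (u m) => [? ?] [? ?].
have {}hIm : (fun n => complex.Im (u n)) @ \oo --> limn (fun n => complex.Im (u n)).
  apply: hIm => e e0; have [n0 hn0] := hu e e0; exists n0 => m n m0 mn.
  apply: le_trans (hn0 m n m0 mn); rewrite -sqrtr_sqr.
  by case: (u n) (u m) => [? ?] [? ?]; rewrite /= ler_wsqrtr // lerDr sqr_ge0.
have [x {}hRe] : exists x : R, (fun n => complex.Re (u n)) @ \oo --> x.
  by exists (limn (fun n => complex.Re (u n))).
have [y {}hIm] : exists y : R, (fun n => complex.Im (u n)) @ \oo --> y.
  by exists (limn (fun n => complex.Im (u n))).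
exists (Complex x y) => e e0; have e2 : 0 < e / 2 by lra.
have /cvgrPdist_le/(_ _ e2)[n1 _ h1] := hRe.
have /cvgrPdist_le/(_ _ e2)[n2 _ h2] := hIm.
exists (maxn n1 n2) => n; rewrite geq_max => /andP[/h1 {}h1 /h2 {}h2].
move: h1 h2; case: (u n) => a b /= h1 h2.
apply: (@le_trans _ _ (Num.sqrt ((`|x - a| + `|y - b|) ^+ 2))).
  rewrite ler_wsqrtr // [leRHS]sqrrD !real_normK ?num_real // lerD2r lerDl.
  by rewrite mulrn_wge0 // mulr_ge0.
by rewrite sqrtr_sqr ger0_norm ?addr_ge0 //; lra.
Qed.

Lemma bounded_disc_expansion a (A : R) : (forall k, cmod (a k) <= A) ->
  exists g, disc_expansion g a.
Proof.
move=> hA; have A0 : 0 <= A := le_trans (cmod_ge0 (a 0%N)) (hA 0%N).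
have ex z : exists l : R[i], unit_disc z -> forall e : R, 0 < e ->
    exists n0, forall n, (n0 <= n)%N -> cmod (l - \sum_(0 <= k < n) a k * z ^+ k) <= e.
  have [zD|nz] := pselect (unit_disc z); last by exists 0.
  have z0 : 0 <= cmod z < 1 by rewrite cmod_ge0.
  have h : 0 < 1 - cmod z by case/andP: z0 => _ ?; lra.
  suff [l hl] : exists l : R[i], forall e : R, 0 < e -> exists n0, forall n,
     (n0 <= n)%N -> cmod (l - \sum_(0 <= k < n) a k * z ^+ k) <= e by exists l.
  apply: cauchy_cvgC => e e0.
  have A1 : 0 < A + 1 by lra.
  have [n0 hn0] := expr_small z0 (divr_gt0 (mulr_gt0 e0 h) A1).
  exists n0 => m n n0m mn.
  rewrite (big_cat_nat (leq0n m) mn) /= [X in cmod X]addrC addKr.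
  apply: le_trans (cmod_sum _ _ _) _.
  apply: (@le_trans _ _ (A * \sum_(m <= k < n) cmod z ^+ k)).
    rewrite mulr_sumr; apply: ler_sum => k _.
    by rewrite cmodM cmodX ler_wpM2r ?exprn_ge0 ?cmod_ge0.
  apply: (@le_trans _ _ (A * (cmod z ^+ m / (1 - cmod z)))).
    by rewrite ler_wpM2l // geometric_sum_le.
  rewrite mulrA ler_pdivrMr //.
  apply: (@le_trans _ _ ((A + 1) * cmod z ^+ n0)).
    apply: ler_pM; rewrite ?exprn_ge0 ?cmod_ge0 //; first by lra.
    by rewrite ler_wiXn2l ?cmod_ge0 //; case/andP: z0 => _ /ltW.
  by rewrite mulrC -ler_pdivlMr.
have [g hg] := choice ex; exists g => z zD; apply/cvg_cmodP; exact: hg.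
Qed.

Lemma disc_expansionN f a : disc_expansion f a ->
  disc_expansion (fun z => - f z) (fun k => - a k).
Proof.
move=> fa z zD.
have -> : (fun n => \sum_(0 <= k < n) - a k * z ^+ k : R[i]^o) =
  (fun n => - (\sum_(0 <= k < n) a k * z ^+ k : R[i]^o)).
  by apply/funext => n; rewrite -sumrN; apply: eq_bigr => k _; rewrite mulNr.
exact: cvgN (fa z zD).
Qed.

Lemma H2normsqN f : (H2normsq (fun z => (- f z)%R) <= H2normsq f)%E.
Proof.
apply/ereal_infP => _ [a fa <-]; apply: ge_ereal_inf.
exists (\sum_(0 <= n <oo) (cmod (- a n) ^+ 2)%:E)%E.
  by exists (fun n => - a n); [exact: disc_expansionN | ].
by under eq_eseriesr do rewrite cmodN.
Qed.

End Completeness.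

Lemma cvge0P (R : realType) (X : nat -> \bar R) : (forall n, (0 <= X n)%E) ->
  X @ \oo --> 0%E <->
  forall e : R, 0 < e -> exists n0, forall n, (n0 <= n)%N -> (X n <= e%:E)%E.
Proof.
move=> X0; split=> [/fine_cvgP[[n1 _ Xfin] /cvgrPdist_le Xc] e e0|hX].
  have [n2 _ h2] := Xc e e0; exists (maxn n1 n2) => n.
  rewrite geq_max => /andP[/Xfin nfin /h2].
  rewrite sub0r normrN /= => h; rewrite -(fineK nfin) lee_fin.
  exact: le_trans (ler_norm _) h.
apply/fine_cvgP; split.
  have [n0 h0] := hX 1 ltr01; exists n0 => // n /h0 h.
  by rewrite ge0_fin_numE //; apply: le_lt_trans h _; rewrite ltry.
apply/cvgrPdist_le => e e0; have [n0 h0] := hX e e0; exists n0 => // n /h0 h.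
have nfin : X n \is a fin_num.
  by rewrite ge0_fin_numE //; apply: le_lt_trans h _; rewrite ltry.
rewrite sub0r normrN ger0_norm /=; first by rewrite -lee_fin fineK.
exact: fine_ge0.
Qed.

(** * Convergence of kernel series *)

Section KernelSeries.
Variables (R : realType) (J : set nat) (lam : nat -> R[i]).
Hypothesis lamD : forall j, J j -> unit_disc (lam j).
Implicit Types (d : nat -> R[i]) (g : R[i] -> R[i]).

Definition initial n : seq nat := [seq j <- index_iota 0 n | j \in J].

Lemma initial_disc n : {in initial n, forall j, unit_disc (lam j)}.
Proof. by move=> j; rewrite mem_filter => /andP[/set_mem/lamD]. Qed.

Lemma initial_uniq n : uniq (initial n).
Proof. by rewrite filter_uniq // iota_uniq. Qed.

Lemma mem_initial n j : (j \in initial n) = (j \in J) && (j < n)%N.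
Proof. by rewrite mem_filter mem_index_iota. Qed.

Definition kernel_series d j z : R[i] := d j * szego (lam j) z.

Lemma partial_sum_comb d n :
  (fun z => \sum_(0 <= j < n | j \in J) kernel_series d j z) = comb lam (initial n) d.
Proof. by apply/funext => z; rewrite /comb big_filter. Qed.

(** Writes a tail as a sum over an initial list, so that estimates over the
    lists [initial n] apply to tails. *)
Lemma initial_tail (V : zmodType) (G : nat -> V) m n : (m <= n)%N ->
  \sum_(j <- initial n) (if (j < m)%N then 0 else G j) =
  \sum_(j <- initial n) G j - \sum_(j <- initial m) G j.
Proof.
move=> mn; rewrite !big_filter !(big_cat_nat (leq0n m) mn) /= addrAC subrr add0r.
rewrite big_nat_cond big1 ?add0r => [|j /andP[/andP[_ ->]] //].
rewrite big_nat_cond [RHS]big_nat_cond; apply: eq_bigr => j /andP[/andP[mj _] _].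
by rewrite ltnNge mj.
Qed.

Lemma initial_homo (G : nat -> R) : (forall j, 0 <= G j) ->
  {homo (fun n => \sum_(j <- initial n) G j) : m n / (m <= n)%N >-> m <= n}.
Proof.
move=> G0 m n mn; rewrite -subr_ge0 -initial_tail //.
by apply: sumr_ge0 => j _; case: ifP.
Qed.

Variable C : R.
Hypothesis carlesonC : forall n, poly_carleson lam (initial n) C.

(** The difference is itself a kernel combination, with the first
    coefficients set to 0, to which [bessel] applies. *)
Lemma comb_coef_tail d m n M : (m <= n)%N ->
  \sum_(k < M) cmod (comb_coef lam (initial n) d k - comb_coef lam (initial m) d k) ^+ 2
  <= C * (\sum_(j <- initial n) cmod (d j) ^+ 2 -
          \sum_(j <- initial m) cmod (d j) ^+ 2).
Proof.
move=> mn; pose d' j := if (j < m)%N then 0 else d j.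
have E k : comb_coef lam (initial n) d k - comb_coef lam (initial m) d k =
    comb_coef lam (initial n) d' k.
  rewrite /comb_coef -initial_tail //; apply: eq_bigr => j _; rewrite /d'.
  by case: ifP; rewrite ?mul0r.
under eq_bigr do rewrite E.
apply: le_trans (bessel _ _ (@initial_disc n) (carlesonC n)) _.
rewrite le_eqVlt; apply/orP; left; apply/eqP; congr (_ * _).
rewrite -initial_tail //; apply: eq_bigr => j _; rewrite /d'.
by case: ifP; rewrite ?cmod0 ?expr0n.
Qed.

(** By [comb_coef_tail], each Taylor coefficient of the partial sums is a
    Cauchy sequence, and the limit coefficients differ from those of the
    [n]-th partial sum by at most a multiple of the tail [l - T n] in norm. *)
Lemma kernel_series_converges d (B : R) :
  (forall n, \sum_(j <- initial n) cmod (d j) ^+ 2 <= B) ->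
  exists g, H2_sums_to J (kernel_series d) g.
Proof.
move=> hB; have C0 := poly_carleson_ge0 (@initial_disc 0) (carlesonC 0).
pose T n := \sum_(j <- initial n) cmod (d j) ^+ 2.
have Tmono : {homo T : m n / (m <= n)%N >-> m <= n}.
  by apply: initial_homo => j; rewrite sqr_ge0.
have Tcvg : cvgn T.
  by apply: nondecreasing_is_cvgn => //; exists B => _ [n _ <-]; exact: hB.
have [l Tl Tlim] : exists2 l : R, forall n, T n <= l &
    forall e, 0 < e -> exists n0, forall n, (n0 <= n)%N -> l - T n <= e.
  exists (limn T) => [n|e e0]; first exact: nondecreasing_cvgn_le.
  have /cvgrPdist_le/(_ e e0)[n0 _ h0] := Tcvg.
  by exists n0 => n /h0; apply: le_trans; exact: ler_norm.
pose s n k := comb_coef lam (initial n) d k.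
have sdiff m n M : (m <= n)%N ->
    \sum_(k < M) cmod (s n k - s m k) ^+ 2 <= C * (l - T m).
  move=> mn; apply: (le_trans (comb_coef_tail d M mn)).
  by rewrite -/(T n) -/(T m) ler_wpM2l // lerD2r.
have exa k : exists x : R[i], forall e : R, 0 < e ->
    exists n0, forall n, (n0 <= n)%N -> cmod (x - s n k) <= e.
  apply: (@cauchy_cvgC R (s^~ k)) => e e0.
  have C1 : 0 < C + 1 by lra.
  have [n0 h0] := Tlim _ (divr_gt0 (exprn_gt0 2 e0) C1).
  exists n0 => m n m0 mn.
  rewrite -(@ler_pXn2r _ 2) ?nnegrE ?cmod_ge0 ?(ltW e0) //.
  apply: (@le_trans _ _ (C * (l - T m))).
    apply: le_trans (sdiff m n k.+1 mn); rewrite big_ord_recr /= lerDr.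
    by apply: sumr_ge0 => j _; rewrite sqr_ge0.
  apply: (@le_trans _ _ ((C + 1) * (l - T m))).
    by rewrite ler_wpM2r ?subr_ge0 //; lra.
  by rewrite mulrC -ler_pdivlMr // h0.
have [a ha] := choice exa.
have slim n M : \sum_(k < M) cmod (s n k - a k) ^+ 2 <= 2 * (C * (l - T n)).
  apply: (@le_of_sqr_eps _ _ _ (\sum_(k < M) 2)); first by apply: sumr_ge0.
  move=> e e0.
  have exN k : exists N, forall n, (N <= n)%N -> cmod (a k - s n k) <= e by exact: ha.
  have [N hN] := choice exN.
  pose n' := (n + \max_(k < M) N k)%N.
  apply: (@le_trans _ _ (\sum_(k < M) (2 * cmod (s n' k - s n k) ^+ 2 + e ^+ 2 * 2))).
    apply: ler_sum => k _; rewrite (cmodB (s n k)) -(subrKA (s n' k)) addrC mulrC.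
    apply: le_trans (cmodD_sqr _ _) _; rewrite mulrC lerD2l mulrC ler_pM2r //.
    rewrite lerXn2r ?nnegrE ?cmod_ge0 ?(ltW e0) // hN //.
    by apply: leq_trans (leq_addl _ _); exact: (leq_bigmax k).
  rewrite big_split /= -!mulr_sumr lerD2r ler_pM2l // sdiff //.
  exact: leq_addr.
have a_bounded M : \sum_(k < M) cmod (a k) ^+ 2 <= 2 * (C * l).
  have := slim 0%N M; rewrite /T /initial /index_iota /= big_nil subr0.
  by under eq_bigr do rewrite /s /comb_coef /initial /index_iota /= big_nil sub0r cmodN.
have [g ga] : exists g, disc_expansion g a.
  apply: (@bounded_disc_expansion _ _ (2 * (C * l) + 1)) => k.
  have : cmod (a k) ^+ 2 <= 2 * (C * l).
    apply: le_trans (a_bounded k.+1); rewrite big_ord_recr /= lerDr.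
    by apply: sumr_ge0 => j _; rewrite sqr_ge0.
  by have := sqr_ge0 (cmod (a k) - 1); have := cmod_ge0 (a k); nra.
exists g; split; first by apply: le_lt_trans (H2normsq_le ga a_bounded) (ltry _).
apply/cvge0P => [n|e e0]; first exact: H2normsq_ge0.
have C1 : 0 < 2 * (C + 1) by lra.
have [n0 h0] := Tlim _ (divr_gt0 e0 C1).
exists n0 => n /h0 hn.
have := disc_expansionD (@disc_expansion_comb R lam _ d (@initial_disc n))
  (disc_expansionN ga).
rewrite -partial_sum_comb => /H2normsq_le; apply => M.
apply: le_trans (slim n M) _.
apply: (@le_trans _ _ (2 * (C + 1) * (l - T n))).
  by rewrite -mulrA ler_pM2l // ler_wpM2r ?subr_ge0 //; lra.
by rewrite mulrC -ler_pdivlMr.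
Qed.

End KernelSeries.

Section SquareSums.
Variables (R : realType) (J : set nat) (c : nat -> R[i]).

Lemma esum_nneseries : (\esum_(j in J) (cmod (c j) ^+ 2)%:E =
  \sum_(0 <= j <oo | j \in J) (cmod (c j) ^+ 2)%:E)%E.
Proof.
rewrite nneseries_esum => [|j _]; last by rewrite lee_fin sqr_ge0.
by congr esum; apply/funext => j; apply/propext; rewrite /= in_setE.
Qed.

Lemma esum_ge_initial n : ((\sum_(j <- initial J n) cmod (c j) ^+ 2)%:E
  <= \esum_(j in J) (cmod (c j) ^+ 2)%:E)%E.
Proof.
rewrite esum_nneseries big_filter -sumEFin.
by apply: nneseries_lim_ge => j _ _; rewrite lee_fin sqr_ge0.
Qed.

Lemma esum_le_initial (B : R) :
  (forall n, \sum_(j <- initial J n) cmod (c j) ^+ 2 <= B) ->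
  (\esum_(j in J) (cmod (c j) ^+ 2)%:E <= B%:E)%E.
Proof.
move=> hB; rewrite esum_nneseries; apply: lime_le.
  by apply: is_cvg_nneseries => n _ _; rewrite lee_fin sqr_ge0.
by near=> n; rewrite sumEFin lee_fin; have := hB n; rewrite big_filter.
Unshelve. all: end_near. Qed.

End SquareSums.

(** * Finitely supported kernel series *)

Section FiniteSums.
Variables (R : realType) (J : set nat) (lam : nat -> R[i]).
Hypothesis lamD : forall j, J j -> unit_disc (lam j).
Implicit Types (d c : nat -> R[i]) (r : seq nat).

Lemma big_initial_support (V : zmodType) (G : nat -> V) r n : uniq r ->
  {in r, forall j, J j} -> (forall j, j \notin r -> G j = 0) ->
  {in r, forall j, (j < n)%N} -> \sum_(j <- initial J n) G j = \sum_(j <- r) G j.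
Proof.
move=> ur rJ G0 rn.
rewrite (bigID (fun j => j \in r)) /= [X in _ + X]big1 ?addr0; last by move=> j /G0.
rewrite -big_filter; apply: perm_big; apply: uniq_perm => //.
  by rewrite filter_uniq // initial_uniq.
move=> j; rewrite mem_filter mem_initial.
by have [jr|//] := boolP (j \in r); rewrite rn // mem_set //; exact: rJ.
Qed.

Lemma bound_seq r : exists N, {in r, forall j, (j < N)%N}.
Proof.
exists (\max_(j <- r) j).+1 => j jr; rewrite ltnS.
by rewrite (big_rem j) //= leq_maxl.
Qed.

(** The partial sums are eventually equal to [comb lam r d], which is thus a
    sum of the series.  The sum selected by [H2_sum] need not be the same
    function, but lies at distance 0 from it, and [H2normsqD] compares the
    norms at the cost of a factor 2. *)
Lemma H2_sum_finite_le d r (A : R) : uniq r -> {in r, forall j, J j} ->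
  (forall j, j \notin r -> d j = 0) ->
  (forall n, \sum_(k < n) cmod (comb_coef lam r d k) ^+ 2 <= A) ->
  (H2normsq (H2_sum J (kernel_series lam d)) <= (2 * A)%:E)%E.
Proof.
move=> ur rJ d0 hA.
have rD : {in r, forall j, unit_disc (lam j)} by move=> j /rJ/lamD.
have [N hN] := bound_seq r.
pose S := comb lam r d.
have Sexp : disc_expansion S (comb_coef lam r d) := disc_expansion_comb rD.
have partialS n : (N <= n)%N ->
    (fun z => \sum_(0 <= j < n | j \in J) kernel_series lam d j z) = S.
  move=> Nn; rewrite partial_sum_comb; apply/funext => z.
  apply: (big_initial_support ur rJ) => j; first by move/d0 ->; rewrite mul0r.
  by move/hN => jN; apply: leq_trans jN Nn.
have SS : H2_sums_to J (kernel_series lam d) S.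
  split; first by apply: le_lt_trans (H2normsq_le Sexp hA) (ltry _).
  apply/cvge0P => [n|e e0]; first exact: H2normsq_ge0.
  exists N => n /partialS hn.
  have -> : (fun z => \sum_(0 <= j < n | j \in J) kernel_series lam d j z - S z) =
      (fun z => S z + - S z).
    by apply/funext => z; have -> := congr1 (fun f => f z) hn.
  apply: (H2normsq_le (disc_expansionD Sexp (disc_expansionN Sexp))) => M.
  by rewrite big1 ?ltW // => k _; rewrite subrr cmod0 expr0n.
have [gH2 gS] : H2_sums_to J (kernel_series lam d) (H2_sum J (kernel_series lam d)).
  by apply: (@getPex (R[i] -> R[i]^o)); exists S.
set g := H2_sum _ _ in gH2 gS *.
have -> : g = (fun z => S z + - (S z - g z)).
  by apply/funext => z; rewrite opprB addrCA subrr addr0.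
apply: le_trans (H2normsqD _ _) _.
have -> : (2 * A)%:E = (2%:E * A%:E + 2%:E * 0)%E :> \bar R by rewrite mule0 adde0 EFinM.
apply: leeD; apply: lee_wpmul2l; rewrite ?lee_fin //; first exact: H2normsq_le Sexp hA.
apply: le_trans (H2normsqN _) _.
apply/lee_addgt0Pr => e e0; rewrite add0e.
have [n0 h0] := (cvge0P (fun n => H2normsq_ge0 _)).1 gS e e0.
apply: le_trans (h0 (maxn n0 N) (leq_maxl _ _)).
have hS := partialS _ (leq_maxr n0 N).
rewrite le_eqVlt; apply/orP; left; apply/eqP; congr H2normsq.
by apply/funext => z; rewrite -[in LHS]hS.
Qed.

End FiniteSums.

(** * Finite sets of indices *)

Lemma card_le_seq (A : set nat) m : (A #<= `I_m)%card ->
  exists2 e : seq nat, uniq e & (size e <= m)%N /\ forall x, (x \in e) = (x \in A).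
Proof.
move=> Am; exists (finmap.enum_fset (fset_set A)); first exact: finmap.fset_uniq.
split=> [|x]; first exact: geq_card_fset_set.
by apply: in_fset_set; apply/finite_set_leP; exists m.
Qed.

Lemma not_card_le_seq (A : set nat) m : ~ (A #<= `I_m)%card ->
  exists2 e : seq nat, uniq e & size e = m.+1 /\ {in e, forall x, A x}.
Proof.
move=> Am; have [e ue [me eA]] : exists2 e : seq nat, uniq e &
    (m < size e)%N /\ {in e, forall x, A x}.
  have [fA|iA] := pselect (finite_set A).
    exists (finmap.enum_fset (fset_set A)); first exact: finmap.fset_uniq.
    split=> [|x]; last by rewrite (in_fset_set fA) in_setE.
    have [n An] := fA; rewrite (card_fset_set An) ltnNge; apply/negP => nm.
    by apply: Am; rewrite (card_le_eql An) card_le_II.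
  have [B BA mB] := infinite_set_fset m.+1 iA.
  exists (finmap.enum_fset B); first exact: finmap.fset_uniq.
  by split=> // x xB; apply: BA.
exists (take m.+1 e); first exact: take_uniq.
split; first by rewrite size_takel.
by move=> x /mem_take; exact: eA.
Qed.

Lemma kernel_vector (K : fieldType) m (a : 'I_m -> 'I_m.+1 -> K) :
  exists2 v : 'I_m.+1 -> K, (exists k, v k != 0) & forall i, \sum_k a i k * v k = 0.
Proof.
pose A := \matrix_(k < m.+1, i < m) a i k.
have : kermx A != 0.
  by rewrite -mxrank_eq0 mxrank_ker subn_eq0 -ltnNge ltnS rank_leq_col.
case/rowV0Pn => u /sub_kermxP uA u0; exists (fun k => u 0 k).
  apply/existsP; apply: contraNT u0; rewrite negb_exists => /forallP h.
  by apply/eqP/rowP => k; rewrite mxE; apply/eqP; have := h k; rewrite negbK.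
move=> i; have := congr1 (fun w : 'rV_m => w 0 i) uA; rewrite !mxE => uA0.
by apply: etrans uA0; apply: eq_bigr => k _; rewrite mxE mulrC.
Qed.

Lemma big_codom (V : zmodType) p (s : 'I_p -> nat) (G : nat -> V) :
  \sum_(j <- codom s) G j = \sum_(k < p) G (s k).
Proof. by rewrite /codom /image_mem big_map big_enum. Qed.

Lemma extend_inj (V : zmodType) p (s : 'I_p -> nat) (v : 'I_p -> V) : injective s ->
  exists2 c : nat -> V, forall k, c (s k) = v k & forall j, j \notin codom s -> c j = 0.
Proof.
move=> sinj; exists (fun j => if [pick k | s k == j] is Some k then v k else 0).
  by move=> k; case: pickP => [l /eqP/sinj -> //|/(_ k)]; rewrite eqxx.
move=> j; apply: contraNeq; case: pickP => [l /eqP <- _|_]; last by rewrite eqxx.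
exact: codom_f.
Qed.

(** * From the global to the local lower bound *)

Section Necessity.
Variables (R : realType) (J : set nat) (m : nat) (lam : nat -> R[i]).
Variables (alpha : 'I_m -> nat -> R[i]) (D : R).
Hypothesis lamD : forall j, J j -> unit_disc (lam j).
Hypothesis alpha1 : forall j, J j -> \sum_(i < m) cmod (alpha i j) ^+ 2 = 1.
Hypothesis bounded_below : forall c : nat -> R[i],
  ((\esum_(j in J) (cmod (c j) ^+ 2)%:E) < +oo)%E ->
  ((D ^+ 2)%:E * (\esum_(j in J) (cmod (c j) ^+ 2)%:E)
     <= \sum_(i < m) H2normsq
          (H2_sum J (kernel_series lam (fun j => (alpha i j * c j)%R))))%E.

(** The global lower bound is applied to the extension of [v] by 0, and
    [comb_coef_nearby] bounds its right side from above.  The last term is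
    the price of moving all the kernels to [lam j]; the factor [p] is
    [sum_i sum_k |alpha^i_(s k)|^2]. *)
Lemma local_bounded_below (eta : R) j p (s : 'I_p -> nat) (v : 'I_p -> R[i]) :
  J j -> injective s -> (forall k, ball_indices J lam eta j (s k)) ->
  D ^+ 2 * \sum_(k < p) cmod (v k) ^+ 2 <=
  4 * (\sum_(i < m) cmod (\sum_(k < p) alpha i (s k) * v k) ^+ 2) +
  8 * eta ^+ 2 * p%:R * \sum_(k < p) cmod (v k) ^+ 2.
Proof.
move=> Jj sinj sball; have [c cs c0] := extend_inj v sinj.
pose r := codom s.
have ur : uniq r by rewrite map_inj_uniq ?enum_uniq.
have rJ : {in r, forall j, J j} by move=> _ /codomP[k ->]; case: (sball k).
have rD : {in r, forall j, unit_disc (lam j)} by move=> k /rJ/lamD.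
have sumr (V : zmodType) (G : nat -> R[i] -> V) :
    \sum_(j <- r) G j (c j) = \sum_(k < p) G (s k) (v k).
  by rewrite big_codom; apply: eq_bigr => k _; rewrite cs.
pose Q := \sum_(k < p) cmod (v k) ^+ 2.
have Q0 : 0 <= Q by apply: sumr_ge0 => k _; rewrite sqr_ge0.
have c20 k : k \notin r -> cmod (c k) ^+ 2 = 0 by move/c0 ->; rewrite cmod0 expr0n.
have esumQ : (\esum_(j in J) (cmod (c j) ^+ 2)%:E = Q%:E)%E.
  have Qr : Q = \sum_(j <- r) cmod (c j) ^+ 2.
    by rewrite (sumr _ (fun _ x => cmod x ^+ 2)).
  have [N hN] := bound_seq r.
  apply/eqP; rewrite eq_le; apply/andP; split; last first.
    by rewrite Qr -(big_initial_support ur rJ c20 hN); exact: esum_ge_initial.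
  apply: esum_le_initial => n.
  rewrite Qr -(big_initial_support (n := maxn n N) ur rJ c20).
    by apply: initial_homo; [move=> k; rewrite sqr_ge0 | exact: leq_maxl].
  by move=> k /hN kN; apply: leq_trans kN (leq_maxr _ _).
have := bounded_below (c := c); rewrite esumQ ltry => /(_ isT).
pose S i := cmod (\sum_(k < p) alpha i (s k) * v k) ^+ 2.
pose a i := \sum_(k < p) cmod (alpha i (s k)) ^+ 2.
pose A i := 2 * S i + 4 * eta ^+ 2 * (a i * Q).
have hA i : (H2normsq (H2_sum J (kernel_series lam (fun j => (alpha i j * c j)%R)))
    <= (2 * A i)%:E)%E.
  apply: (H2_sum_finite_le lamD ur rJ) => [k /c0 ->|n]; first by rewrite mulr0.
  have near_j : {in r, forall k, pseudo_hyperbolic (lam j) (lam k) <= eta}.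
    by move=> _ /codomP[k ->]; have [_ [_ /ltW]] := sball k.
  apply: le_trans (comb_coef_nearby _ _ n (lamD Jj) rD near_j) _.
  rewrite (sumr _ (fun k x => alpha i k * x)) (sumr _ (fun _ x => cmod x ^+ 2)).
  by rewrite (sumr _ (fun k _ => cmod (alpha i k) ^+ 2)).
move=> h; have {h} : ((D ^+ 2 * Q)%:E <= \sum_(i < m) (2 * A i)%:E)%E.
  by rewrite EFinM; apply: le_trans h _; apply: lee_sum => i _; exact: hA.
rewrite sumEFin lee_fin => h; apply: le_trans h _.
have suma : \sum_(i < m) a i = p%:R.
  rewrite /a exchange_big /=; under eq_bigr => k _.
    rewrite alpha1; last by case: (sball k).
    over.
  by rewrite sumr_const card_ord.
rewrite -mulr_sumr big_split /= -!mulr_sumr -mulr_suml suma.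
by rewrite le_eqVlt; apply/orP; left; apply/eqP; rewrite /S /Q; ring.
Qed.

Lemma bounded_below_local : 0 < D -> exists eta D0 : R, [/\ 0 < eta < 1, 0 < D0,
     forall j, J j -> (ball_indices J lam eta j #<= `I_m)%card
   & forall j, J j ->
       forall (p : nat) (s : 'I_p -> nat), (p <= m)%N ->
         injective s -> range s = ball_indices J lam eta j ->
         forall c : 'I_p -> R[i],
           D0 ^+ 2 * \sum_(k < p) cmod (c k) ^+ 2
             <= \sum_(i < m) cmod (\sum_(k < p) alpha i (s k) * c k) ^+ 2].
Proof.
move=> D0.
have m0 : 0 < m.+1%:R :> R by rewrite ltr0n.
(* This radius makes the error term of [local_bounded_below] at most
   [D ^+ 2 / 2] times the squared norm of [v], for up to [m.+1] indices. *)
pose eta := Num.min (1 / 2) (D / (4 * m.+1%:R)).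
have eta0 : 0 < eta by rewrite lt_min !divr_gt0 ?mulr_gt0.
have etaD : 8 * eta ^+ 2 * m.+1%:R <= D ^+ 2 / 2.
  have e1 : eta <= D / (4 * m.+1%:R) by rewrite ge_min lexx orbT.
  have {}e1 : 4 * m.+1%:R * eta <= D.
    by move: e1; rewrite ler_pdivlMr ?mulr_gt0 // mulrC.
  have m1 : 1 <= m.+1%:R :> R by rewrite ler1n.
  have : (4 * eta * m.+1%:R) ^+ 2 <= D ^+ 2.
    rewrite lerXn2r ?nnegrE ?(ltW D0) //; first by rewrite !mulr_ge0 // ltW.
    by rewrite mulrAC.
  have : m.+1%:R <= m.+1%:R ^+ 2 :> R by rewrite expr2; nra.
  by have := sqr_ge0 eta; rewrite !exprMn; nra.
have key j p (s : 'I_p -> nat) (v : 'I_p -> R[i]) : J j -> (p <= m.+1)%N ->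
    injective s -> (forall k, ball_indices J lam eta j (s k)) ->
    D ^+ 2 / 8 * \sum_(k < p) cmod (v k) ^+ 2 <=
    \sum_(i < m) cmod (\sum_(k < p) alpha i (s k) * v k) ^+ 2.
  move=> Jj pm sinj sball; have := local_bounded_below v Jj sinj sball.
  set Q := \sum_(k < p) _; set S := \sum_(i < m) _ => h.
  have Q0 : 0 <= Q by apply: sumr_ge0 => k _; rewrite sqr_ge0.
  have : 8 * eta ^+ 2 * p%:R * Q <= D ^+ 2 / 2 * Q.
    rewrite ler_wpM2r //; apply: le_trans etaD; rewrite ler_wpM2l ?ler_nat //.
    by rewrite mulr_ge0 ?sqr_ge0.
  by lra.
exists eta, (D / 4); split.
- by rewrite eta0 /= gt_min; apply/orP; left; lra.
- by rewrite divr_gt0.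
- move=> j Jj; apply: contrapT => /not_card_le_seq[e ue [se eball]].
  pose s (k : 'I_m.+1) := nth 0%N e k.
  have sinj : injective s.
    by move=> k l /eqP; rewrite nth_uniq ?se ?ltn_ord // => /eqP/val_inj.
  have sball k : ball_indices J lam eta j (s k) by apply: eball; rewrite mem_nth ?se.
  have [v [k vk] av] := kernel_vector (fun i k => alpha i (s k)).
  have := key j _ s v Jj (leqnn _) sinj sball.
  rewrite [leRHS]big1 => [|i _]; last by rewrite av cmod0 expr0n.
  apply/negP; rewrite -ltNge mulr_gt0 ?divr_gt0 ?exprn_gt0 // (bigD1 k) //=.
  rewrite ltr_wpDr ?exprn_gt0 ?cmod_neq0 //.
  by apply: sumr_ge0 => l _; rewrite sqr_ge0.
- move=> j Jj p s pm sinj srange c.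
  apply: le_trans (key j p s c Jj (leqW pm) sinj _).
    rewrite ler_wpM2r //; first by apply: sumr_ge0 => k _; rewrite sqr_ge0.
    by have := sqr_ge0 D; rewrite expr_div_n; lra.
  by move=> k; rewrite -srange; exists k.
Qed.

End Necessity.

(** * From the local to the global lower bound *)

Section Sufficiency.
Variables (R : realType) (J : set nat) (m : nat) (lam : nat -> R[i]).
Variables (alpha : 'I_m -> nat -> R[i]) (eta D0 C : R).
Hypothesis lamD : forall j, J j -> unit_disc (lam j).
Hypothesis alpha1 : forall j, J j -> \sum_(i < m) cmod (alpha i j) ^+ 2 = 1.
Hypothesis carlesonC : forall n, poly_carleson lam (initial J n) C.
Hypotheses (C0 : 0 < C) (eta0 : 0 < eta) (D00 : 0 < D0).
Hypothesis few : forall j, J j -> (ball_indices J lam eta j #<= `I_m)%card.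
Hypothesis local_lower : forall j, J j ->
  forall (p : nat) (s : 'I_p -> nat), (p <= m)%N ->
    injective s -> range s = ball_indices J lam eta j ->
    forall c : 'I_p -> R[i],
      D0 ^+ 2 * \sum_(k < p) cmod (c k) ^+ 2
        <= \sum_(i < m) cmod (\sum_(k < p) alpha i (s k) * c k) ^+ 2.

(** The local hypothesis speaks of all the indices in a ball; it is restricted
    to the indices below [n] by taking coefficients that vanish on the
    others. *)
Lemma local_lower_initial n : {in initial J n, forall j (d : nat -> R[i]),
   D0 ^+ 2 * \sum_(s <- initial J n | pseudo_hyperbolic (lam j) (lam s) < eta)
      cmod (d s) ^+ 2 <=
   \sum_(i < m) cmod (\sum_(s <- initial J n | pseudo_hyperbolic (lam j) (lam s) < eta)
      alpha i s * d s) ^+ 2}.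
Proof.
move=> j jn d; have Jj : J j by move: jn; rewrite mem_initial => /andP[/set_mem].
have [e ue [em eball]] := card_le_seq (few Jj).
pose s (k : 'I_(size e)) := nth 0%N e k.
have sinj : injective s.
  by move=> k l /eqP; rewrite nth_uniq ?ltn_ord // => /eqP/val_inj.
have srange : range s = ball_indices J lam eta j.
  apply/seteqP; split=> [_ [k _ <-]|x xb].
    by rewrite -in_setE -eball mem_nth.
  have xe : x \in e by rewrite eball in_setE.
  have xs : (index x e < size e)%N by rewrite index_mem.
  by exists (Ordinal xs) => //; rewrite /s /= nth_index.
pose d' x := if x \in initial J n then d x else 0.
have sumE (V : zmodType) (G : nat -> R[i] -> V) : (forall x, G x 0 = 0) ->
    \sum_(k < size e) G (s k) (d' (s k)) =
    \sum_(x <- initial J n | pseudo_hyperbolic (lam j) (lam x) < eta) G x (d x).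
  move=> G0; have -> : \sum_(k < size e) G (s k) (d' (s k)) = \sum_(x <- e) G x (d' x).
    by rewrite (big_nth 0%N) big_mkord.
  rewrite (bigID (fun x => x \in initial J n)) /= [X in _ + X]big1 ?addr0; last first.
    by move=> x xn; rewrite /d' (negbTE xn).
  rewrite -big_filter -[RHS]big_filter.
  have pe : perm_eq [seq x <- e | x \in initial J n]
      [seq x <- initial J n | pseudo_hyperbolic (lam j) (lam x) < eta].
    apply: uniq_perm => [||x]; first by rewrite filter_uniq.
      by apply: filter_uniq; exact: initial_uniq.
    rewrite mem_filter [RHS]mem_filter [LHS]andbC eball.
    have [xn|] := boolP (x \in initial J n); last by rewrite !andbF.
    rewrite !andbT; have Jx : J x by move: xn; rewrite mem_initial => /andP[/set_mem].
    apply/idP/idP => [/set_mem[_ []]|h] //.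
    by apply/mem_set; split=> //; split=> //; exact: lamD.
  rewrite (perm_big _ pe) big_seq [RHS]big_seq; apply: eq_bigr => x.
  by rewrite mem_filter /d' => /andP[_ ->].
have := local_lower Jj em sinj srange (fun k => d' (s k)).
rewrite (sumE _ (fun _ x => cmod x ^+ 2)); last by rewrite cmod0 expr0n.
move=> h; apply: le_trans h _; apply: ler_sum => i _.
by rewrite (sumE _ (fun x y => alpha i x * y)) // => x; rewrite mulr0.
Qed.

Lemma alpha_le1 i j : J j -> cmod (alpha i j) ^+ 2 <= 1.
Proof.
move=> Jj; rewrite -(alpha1 Jj) (bigD1 i) //= lerDl.
by apply: sumr_ge0 => k _; rewrite sqr_ge0.
Qed.

Lemma local_bounded_below_global : exists D : R, 0 < D /\
  forall c : nat -> R[i],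
    ((\esum_(j in J) (cmod (c j) ^+ 2)%:E) < +oo)%E ->
    ((D ^+ 2)%:E * (\esum_(j in J) (cmod (c j) ^+ 2)%:E)
     <= \sum_(i < m) H2normsq (H2_sum J
          (kernel_series lam (fun j => (alpha i j * c j)%R))))%E.
Proof.
pose kappa := D0 ^+ 2 * expR (- (2 * C / eta ^+ 2)) / (16 * C).
have kappa0 : 0 < kappa by rewrite divr_gt0 ?mulr_gt0 ?exprn_gt0 ?expR_gt0.
exists (Num.sqrt (kappa / 2)); split; first by rewrite sqrtr_gt0 divr_gt0.
move=> c cfin; rewrite sqr_sqrtr; last by rewrite divr_ge0 // ltW.
pose d i j := alpha i j * c j.
have [B hB] : exists B : R, forall n, \sum_(j <- initial J n) cmod (c j) ^+ 2 <= B.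
  exists (fine (\esum_(j in J) (cmod (c j) ^+ 2)%:E)%E) => n.
  rewrite -lee_fin fineK; first exact: esum_ge_initial.
  rewrite ge0_fin_numE //; apply: esum_ge0 => j _; by rewrite lee_fin sqr_ge0.
have sums i :
    H2_sums_to J (kernel_series lam (d i)) (H2_sum J (kernel_series lam (d i))).
  apply: (@getPex (R[i] -> R[i]^o)).
  apply: (@kernel_series_converges R J lam lamD C carlesonC (d i) B) => n.
  apply: le_trans (hB n); rewrite big_seq [leRHS]big_seq; apply: ler_sum => j.
  rewrite mem_initial => /andP[/set_mem Jj _].
  by rewrite /d cmodM exprMn ler_piMl ?sqr_ge0 ?alpha_le1.
pose g i := H2_sum J (kernel_series lam (d i)).
have gfin i : H2normsq (g i) \is a fin_num.
  by rewrite (ge0_fin_numE (H2normsq_ge0 _)); case: (sums i).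
pose G i := fine (H2normsq (g i)).
have gG i : (H2normsq (g i) <= (G i)%:E)%E by rewrite /G fineK.
(* The finite bound is applied to a partial sum that is both longer than
   [n] and close to [g i] for every [i]. *)
have main n : kappa * \sum_(j <- initial J n) cmod (c j) ^+ 2 <= 2 * \sum_(i < m) G i.
  apply/ler_addgt0Pr => e e0.
  have m1 : 0 < 2 * (m%:R + 1) :> R by rewrite mulr_gt0 // ltr_wpDl.
  pose e' := e / (2 * (m%:R + 1)).
  have e'0 : 0 < e' by rewrite divr_gt0.
  have exN i : exists N, forall n, (N <= n)%N -> (H2normsq (fun z =>
     (\sum_(0 <= j < n | j \in J) kernel_series lam (d i) j z - g i z)%R) <= e'%:E)%E.
    by have [_ /(cvge0P (fun n => H2normsq_ge0 _)).1 h] := sums i; exact: h.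
  have [N hN] := choice exN.
  pose n' := (n + \max_(i < m) N i)%N.
  have nn' : (n <= n')%N := leq_addr _ _.
  have A i k : \sum_(l < k) cmod (comb_coef lam (initial J n') (d i) l) ^+ 2
      <= 2 * e' + 2 * G i.
    have := H2normsq_ge k
      (@disc_expansion_comb R lam _ (d i) (initial_disc lamD (n := n'))).
    have -> : comb lam (initial J n') (d i) =
        (fun z => (comb lam (initial J n') (d i) z - g i z) + g i z).
      by apply/funext => z; rewrite subrK.
    move=> /le_trans h; rewrite -lee_fin; apply: h.
    rewrite -[(2 * e' + 2 * G i)%:E]/(2%:E * e'%:E + 2%:E * (G i)%:E)%E.
    apply: le_trans (H2normsqD _ _) _.
    apply: leeD; apply: lee_wpmul2l; rewrite ?lee_fin //.
    rewrite -partial_sum_comb; apply: hN.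
    by apply: leq_trans (leq_addl _ _); exact: (leq_bigmax i).
  have := finite_lower_bound (initial_disc lamD (n := n')) eta0 (carlesonC n')
    (@local_lower_initial n') A => h.
  apply: (@le_trans _ _ (kappa * \sum_(j <- initial J n') cmod (c j) ^+ 2)).
    rewrite ler_pM2l //; apply: initial_homo nn' => j; exact: sqr_ge0.
  have -> : kappa * \sum_(j <- initial J n') cmod (c j) ^+ 2 =
     (16 * C)^-1 * (D0 ^+ 2 * expR (- (2 * C / eta ^+ 2)) *
       \sum_(j <- initial J n') cmod (c j) ^+ 2).
    by rewrite /kappa; ring.
  rewrite ler_pdivrMl ?mulr_gt0 //; apply: le_trans h _.
  have -> : \sum_(i < m) (2 * e' + 2 * G i) = 2 * e' * m%:R + 2 * \sum_(i < m) G i.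
    rewrite big_split /= sumr_const card_ord -mulr_sumr.
    by rewrite -[in LHS](mulr_natr (2 * e')).
  rewrite ler_pM2l ?mulr_gt0 // [leRHS]addrC lerD2r.
  have e'E : e' * (2 * (m%:R + 1)) = e by rewrite /e' divfK // gt_eqF.
  by rewrite -e'E; lra.
have esumG : (\esum_(j in J) (cmod (c j) ^+ 2)%:E
    <= (2 / kappa * \sum_(i < m) G i)%:E)%E.
  apply: esum_le_initial => n; have := main n.
  by rewrite -ler_pdivlMl // mulrCA mulrA.
apply: (@le_trans _ _ ((kappa / 2)%:E * (2 / kappa * \sum_(i < m) G i)%:E)%E).
  by apply: lee_wpmul2l => //; rewrite lee_fin divr_ge0 // ltW.
rewrite -EFinM.
have -> : kappa / 2 * (2 / kappa * \sum_(i < m) G i) = \sum_(i < m) G i.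
  by field; rewrite gt_eqF.
by rewrite -sumEFin; apply: lee_sum => i _; rewrite /G fineK.
Qed.

End Sufficiency.

Theorem theorem2p4 (R : realType) (J : set nat) (m : nat)
    (lam : nat -> R[i]) (alpha : 'I_m -> nat -> R[i])
    (hJ : J = [set: nat] \/ exists n : nat, J = `I_n)
    (hm : (1 <= m)%N)
    (hlam : forall j, J j -> unit_disc (lam j))
    (hcarl : Carleson (point_masses J lam))
    (halpha : forall j, J j -> \sum_(i < m) cmod (alpha i j) ^+ 2 = 1) :
  (exists D : R, 0 < D /\
     forall c : nat -> R[i],
       ((\esum_(j in J) (cmod (c j) ^+ 2)%:E) < +oo)%E ->
       ((D ^+ 2)%:E * (\esum_(j in J) (cmod (c j) ^+ 2)%:E)
          <= \sum_(i < m)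
               H2normsq (H2_sum J (fun j z =>
                 (alpha i j * c j * szego (lam j) z)%R)))%E)
  <->
  (exists eta D0 : R, [/\ 0 < eta < 1, 0 < D0,
     forall j, J j -> (ball_indices J lam eta j #<= `I_m)%card
   & forall j, J j ->
       forall (p : nat) (s : 'I_p -> nat), (p <= m)%N ->
         injective s -> range s = ball_indices J lam eta j ->
         forall c : 'I_p -> R[i],
           D0 ^+ 2 * \sum_(k < p) cmod (c k) ^+ 2
             <= \sum_(i < m) cmod (\sum_(k < p) alpha i (s k) * c k) ^+ 2]).
Proof.
split=> [[D [D0 hD]]|[eta [D0 [/andP[eta0 _] D00 few local]]]].
  exact: bounded_below_local hlam halpha hD D0.
have [C C0 hC] := Carleson_poly hlam hcarl.
exact: (local_bounded_below_global hlam halpha hC C0 eta0 D00 few local).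
Qed.
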